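(* Let $r_3(\boldsymbol{k})=\prod_{j=1}^d\max(1,\log|k_j|)$ for $\boldsymbol{k}\in\mathbb{Z}^d$ (with $\log0=-\infty$, so factors with $k_j=0$ equal $1$). There exists a constant $C>0$ such that for every $d\in\mathbb{N}$ and every $\varepsilon\in(0,1)$, \[n^{\mathrm{wor}}(\varepsilon,d,F_{d,r_3})\leq C\,d^3\varepsilon^{-3}/\log(d\varepsilon^{-1}).\]
   Context: For a weight function $r:\mathbb{Z}^d\to[1,\infty)$, let \[F_{d,r}=\Big\{f\in C([0,1)^d)\ \text{real-valued}:\ \|f\|:=\sum_{\boldsymbol{k}\in\mathbb{Z}^d}|\hat f(\boldsymbol{k})|\,r(\boldsymbol{k})<\infty\Big\},\qquad \hat f(\boldsymbol{k})=\int_{[0,1)^d}f(\boldsymbol{x})e^{-2\pi\mathrm{i}\boldsymbol{k}\cdot\boldsymbol{x}}\,\mathrm{d}\boldsymbol{x}.\] Let $I_d(f)=\int_{[0,1)^d}f$. A linear algorithm using $n$ points is $Q_{d,n}(f)=\sum_{h=0}^{n-1}c_hf(\boldsymbol{x}_h)$ with $\boldsymbol{x}_h\in[0,1)^d$, $c_h\in\mathbb{R}$; $e^{\mathrm{wor}}(F_{d,r},Q_{d,n})=\sup_{\|f\|\leq1}|I_d(f)-Q_{d,n}(f)|$ and $n^{\mathrm{wor}}(\varepsilon,d,F_{d,r})=\min\{n:\exists Q_{d,n},\ e^{\mathrm{wor}}(F_{d,r},Q_{d,n})\leq\varepsilon\}$. $\log$ is the natural logarithm. *)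

(* Defs.v *)
From HB Require Import structures.
From mathcomp Require Import all_boot all_order all_algebra.
From mathcomp Require Import all_classical all_reals all_analysis.
From mathcomp Require Import complex.

Set Implicit Arguments.
Unset Strict Implicit.
Unset Printing Implicit Defensive.
Import Order.TTheory GRing.Theory Num.Theory.
Import numFieldNormedType.Exports.
Local Open Scope classical_set_scope.
Local Open Scope ring_scope.

(** The library has no measurable structure on ['rV[R]_d]: as for tuples, use
    the sigma-algebra generated by the coordinates. *)
Definition rV_display : measure_display -> measure_display.
Proof. exact. Qed.

Section measurable_rV.
Context {disp : measure_display} {T : measurableType disp} (d : nat).

Let coord : 'I_d -> 'rV[T]_d -> T := fun i x => x ord0 i.

Let rV_set0 : g_sigma_preimage coord set0.
Proof. exact: sigma_algebra0. Qed.

Let rV_setC A : g_sigma_preimage coord A -> g_sigma_preimage coord (~` A).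
Proof. exact: sigma_algebraC. Qed.

Let rV_bigcup (F : (set 'rV[T]_d)^nat) :
  (forall i, g_sigma_preimage coord (F i)) ->
  g_sigma_preimage coord (\bigcup_i F i).
Proof. exact: sigma_algebra_bigcup. Qed.

HB.instance Definition _ := @isMeasurable.Build (rV_display disp)
  'rV[T]_d (g_sigma_preimage coord) rV_set0 rV_setC rV_bigcup.

Lemma measurable_coord (i : 'I_d) :
  measurable_fun [set: 'rV[T]_d] (fun x => x ord0 i).
Proof.
move=> _ Y mY; rewrite setTI; apply: sub_sigma_algebra => /=.
rewrite -bigcup_seq/=; exists i => /=; first by rewrite mem_index_enum.
by exists Y => //; rewrite setTI.
Qed.

Lemma measurable_fun_rVP disp1 (T1 : measurableType disp1) (f : T1 -> 'rV[T]_d) :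
  measurable_fun [set: T1] f <->
  forall i, measurable_fun [set: T1] (fun x => f x ord0 i).
Proof.
split=> [mf i|mf _ A mA].
  apply: (@measurableT_comp _ _ _ _ _ _ (fun x : 'rV[T]_d => x ord0 i)) => //.
  exact: measurable_coord.
rewrite setTI; pose G := [set B : set 'rV[T]_d | measurable (f @^-1` B)].
suff /(_ A mA) : measurable `<=` G by [].
apply: smallest_sub.
  split => [|B mB|F mF]; rewrite /G/=.
  - by rewrite preimage_set0.
  - by rewrite setTD preimage_setC; exact: measurableC.
  - rewrite preimage_bigcup; apply: bigcup_measurable => k _; exact: mF.
move=> B; rewrite -bigcup_seq/= => -[i _ [C mC <-]].
by rewrite /G/= setTI -[X in measurable X]setTI; exact: mf.
Qed.

End measurable_rV.

Section lebesgue_rV.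
Context {R : realType}.

Definition rV_cons (d : nat) (p : measurableTypeR R * 'rV[R]_d) : 'rV[R]_d.+1 :=
  row_mx (const_mx p.1 : 'rV_1) p.2.

Definition rV_uncons (d : nat) (x : 'rV[R]_d.+1) : measurableTypeR R * 'rV[R]_d :=
  (x ord0 ord0, \row_i x ord0 (lift ord0 i)).

Lemma rV_cons0 d p : @rV_cons d p ord0 ord0 = p.1.
Proof.
transitivity ((const_mx p.1 : 'rV[R]_1) ord0 ord0); last by rewrite mxE.
rewrite -(@row_mxEl _ 1 1 d (const_mx p.1) p.2 ord0 ord0).
by congr (row_mx _ _ _ _); exact/val_inj.
Qed.

Lemma rV_consS d p i : @rV_cons d p ord0 (lift ord0 i) = p.2 ord0 i.
Proof.
rewrite -(@row_mxEr _ 1 1 d (const_mx p.1) p.2 ord0 i).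
by congr (row_mx _ _ _ _); exact/val_inj.
Qed.

Lemma rV_consK d : cancel (@rV_cons d) (@rV_uncons d).
Proof.
move=> p; rewrite /rV_uncons rV_cons0 [RHS]surjective_pairing; congr (_, _).
by apply/rowP => i; rewrite mxE rV_consS.
Qed.

Lemma measurable_rV_cons d : measurable_fun setT (@rV_cons d).
Proof.
apply/measurable_fun_rVP => i; case: (unliftP ord0 i) => [j ->|->].
- under eq_fun do rewrite rV_consS.
  apply: (@measurableT_comp _ _ _ _ _ _ (fun x : 'rV[R]_d => x ord0 j)) => //.
  exact: measurable_coord.
- by under eq_fun do rewrite rV_cons0; exact: measurable_fst.
Qed.

Lemma measurable_rV_uncons d : measurable_fun setT (@rV_uncons d).
Proof.
apply/measurable_fun_pairP; split; first exact: measurable_coord.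
apply/measurable_fun_rVP => i.
rewrite (_ : (fun _ => _) = fun x : 'rV[R]_d.+1 => x ord0 (lift ord0 i)).
  exact: measurable_coord.
by apply/funext => x; rewrite /= mxE.
Qed.

Section step.
Variables (d : nat) (mu : {sigma_finite_measure set 'rV[R]_d -> \bar R}).

Definition lebesgue_rV_step : set 'rV[R]_d.+1 -> \bar R :=
  pushforward (lebesgue_measure \x mu)%E (@rV_cons d).

Let step0 : lebesgue_rV_step set0 = 0%E.
Proof. by rewrite /lebesgue_rV_step /pushforward preimage_set0 measure0. Qed.

Let step_ge0 A : (0 <= lebesgue_rV_step A)%E.
Proof. by rewrite /lebesgue_rV_step /pushforward. Qed.

Let step_sigma_additive : semi_sigma_additive lebesgue_rV_step.
Proof.
have mcons (A : set 'rV[R]_d.+1) :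
    measurable A -> measurable (@rV_cons d @^-1` A).
  by move=> mA; rewrite -[X in measurable X]setTI; exact: measurable_rV_cons.
move=> F mF tF mUF; rewrite /lebesgue_rV_step /pushforward preimage_bigcup.
apply: measure_semi_sigma_additive.
- by move=> n; exact: mcons.
- apply/trivIsetP => /= i j _ _ ij; rewrite -preimage_setI.
  by move/trivIsetP : tF => /(_ _ _ _ _ ij) ->//; rewrite preimage_set0.
- by rewrite -preimage_bigcup; exact: mcons.
Qed.

HB.instance Definition _ := isMeasure.Build _ _ _
  lebesgue_rV_step step0 step_ge0 step_sigma_additive.

Let sigma_finite_step : sigma_finite setT lebesgue_rV_step.
Proof.
have /sigma_finiteP[F [TF ndF Foo]] := sigma_finiteT (@lebesgue_measure R).
have /sigma_finiteP[G [TG ndG Goo]] := sigma_finiteT mu.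
exists (fun n => @rV_uncons d @^-1` (F n `*` G n)).
  rewrite -preimage_bigcup -(preimage_setT (@rV_uncons d)); congr (_ @^-1` _).
  apply/seteqP; split=> // -[x y] _.
  have [n _ Fnx] : (\bigcup_k F k) x by rewrite -TF.
  have [k _ Gky] : (\bigcup_k G k) y by rewrite -TG.
  exists (maxn n k) => //; split => /=.
  - by move: x Fnx; exact/subsetPset/ndF/leq_maxl.
  - by move: y Gky; exact/subsetPset/ndG/leq_maxr.
move=> n; have [mF Fn] := Foo n; have [mG Gn] := Goo n; split.
  rewrite -[X in measurable X]setTI.
  by apply: measurable_rV_uncons => //; exact: measurableX.
rewrite /lebesgue_rV_step /pushforward -comp_preimage.
rewrite (_ : _ \o _ = id) ?preimage_id; last first.
  by apply/funext => p /=; rewrite rV_consK.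
by rewrite product_measure1E// lte_mul_pinfty// ge0_fin_numE.
Qed.

HB.instance Definition _ :=
  Measure_isSigmaFinite.Build _ _ _ lebesgue_rV_step sigma_finite_step.

End step.

(** Lebesgue measure on ['rV[R]_d], as iterated product of [lebesgue_measure]. *)
Fixpoint lebesgue_rV (d : nat) : {sigma_finite_measure set 'rV[R]_d -> \bar R} :=
  match d with
  | 0 => \d_(0 : 'rV[R]_0)
  | d'.+1 => lebesgue_rV_step (lebesgue_rV d')
  end.

End lebesgue_rV.
Arguments lebesgue_rV {R} d : simpl never.

Section function_space.
Context {R : realType}.

(** [unit_cube d] is [[0,1)^d]. *)
Definition unit_cube (d : nat) : set 'rV[R]_d :=
  [set x | forall j, 0 <= x ord0 j < 1].
Arguments unit_cube : clear implicits.

Lemma measurable_unit_cube d : measurable (unit_cube d).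
Proof.
rewrite (_ : unit_cube d =
    \bigcap_(j in [set: 'I_d]) (fun x : 'rV[R]_d => x ord0 j) @^-1` `[0, 1[).
  apply: fin_bigcap_measurable => // j _; rewrite -[X in measurable X]setTI.
  exact: measurable_coord.
apply/seteqP; split=> [x cx j _|x cx j]; first by rewrite /= in_itv/=; exact: cx.
by have := cx j I; rewrite /= in_itv.
Qed.

Lemma lebesgue_rV_unit_cube d : lebesgue_rV d (unit_cube d) = 1%E.
Proof.
elim: d => [|d IHd]; first by rewrite /= diracE mem_set// => -[].
transitivity ((lebesgue_measure \x lebesgue_rV d)%E (`[0%R, 1%R[ `*` unit_cube d)).
  rewrite /= /lebesgue_rV_step /pushforward; congr product_measure1.
  apply/seteqP; split=> -[a x] /= => [h|[ha h] j].
  - split; first by have := h ord0; rewrite rV_cons0 in_itv.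
    by move=> j; have := h (lift ord0 j); rewrite rV_consS.
  - by case: (unliftP ord0 j) => [i ->|->]; rewrite ?rV_consS ?rV_cons0 //; exact: h.
rewrite product_measure1E; [|exact: measurable_itv|exact: measurable_unit_cube].
rewrite [X in (_ * X)%E](_ : _ = 1%E) ?mule1; last exact: IHd.
transitivity (@lebesgue_measure R `[0%R, 1%R[); first by [].
by rewrite lebesgue_measure_itv/= lte_fin ltr01 oppr0 adde0.
Qed.

Definition dotZ (d : nat) (k : 'rV[int]_d) (x : 'rV[R]_d) : R :=
  \sum_(j < d) (k ord0 j)%:~R * x ord0 j.

(** [expi t] is [e^(i t)]. *)
Definition expi (t : R) : R[i] := (cos t +i* sin t)%C.

Definition complex_integral (d : nat) (g : 'rV[R]_d -> R[i]) : R[i] :=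
  (Rintegral (lebesgue_rV d) (unit_cube d) (fun x => complex.Re (g x)) +i*
   Rintegral (lebesgue_rV d) (unit_cube d) (fun x => complex.Im (g x)))%C.

Definition fourier_coef (d : nat) (f : 'rV[R]_d -> R) (k : 'rV[int]_d) : R[i] :=
  complex_integral
    (fun x => ((f x)%:C)%C * expi (- (2 * pi * dotZ k x))).

Definition Fnorm (d : nat) (r : 'rV[int]_d -> R) (f : 'rV[R]_d -> R) : \bar R :=
  \esum_(k in [set: 'rV[int]_d])
    (ComplexField.Normc.normc (fourier_coef f k) * r k)%:E.

(** Only the values of [f] on the cube matter. Continuity on the half-open cube
    does not bound [f], so integrability, which makes the Fourier coefficients
    meaningful, is explicit. *)
Definition Fspace (d : nat) (r : 'rV[int]_d -> R) : set ('rV[R]_d -> R) :=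
  [set f | [/\ {within unit_cube d, continuous f},
              (lebesgue_rV d).-integrable (unit_cube d) (EFin \o f) &
              (Fnorm r f < +oo)%E]].

Definition Iint (d : nat) (f : 'rV[R]_d -> R) : R :=
  Rintegral (lebesgue_rV d) (unit_cube d) f.

Definition linear_algorithm (d n : nat) (c : 'I_n -> R) (x : 'I_n -> 'rV[R]_d)
    (f : 'rV[R]_d -> R) : R :=
  \sum_(h < n) c h * f (x h).

Definition ewor (d : nat) (r : 'rV[int]_d -> R) (Q : ('rV[R]_d -> R) -> R) :
    \bar R :=
  ereal_sup [set `|Iint f - Q f|%:E |
    f in [set f | Fspace r f /\ (Fnorm r f <= 1)%E]].

Definition reaches (eps : R) (d : nat) (r : 'rV[int]_d -> R) (n : nat) : Prop :=
  exists (c : 'I_n -> R) (x : 'I_n -> 'rV[R]_d),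
    (forall h, unit_cube d (x h)) /\
    (ewor r (linear_algorithm c x) <= eps%:E)%E.

(** The minimum over the empty set is [+oo]. *)
Definition nwor (eps : R) (d : nat) (r : 'rV[int]_d -> R) : \bar R :=
  match pselect (exists n, `[< reaches eps r n >]) with
  | left h => (ex_minn h)%:R%:E
  | right _ => +oo%E
  end.

(** [ln 0 = 0] in the library, so the factors with [k_j = 0] are [1], in agreement
    with the convention [log 0 = -oo]. *)
Definition r3 (d : nat) (k : 'rV[int]_d) : R :=
  \prod_(j < d) Num.max 1 (ln (`|k ord0 j|%:~R)).

Lemma r3_ge1 d (k : 'rV[int]_d) : 1 <= r3 k.
Proof.
rewrite /r3; elim/big_ind : _ => // [x y x1 y1|j _].
  by rewrite -[leLHS]mulr1 ler_pM.
by rewrite le_max lexx.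
Qed.

Lemma r3_factor0 : Num.max 1 (ln (`|0 : int|%:~R)) = 1 :> R.
Proof. by rewrite normr0 ln0// max_l. Qed.

End function_space.
Arguments unit_cube {R} d _.
Arguments r3 {R} d k.

(* Main.v *)
(** Idea. For each prime p in (m, 4m], with m of order d/eps, use the p^2 nodes
    with coordinates {h g^j / p} + 1/(2p), j < d (Korobov's p-sets, with two
    parameters g and h), and average over p.  On a frequency k not divisible by
    p, summing over h kills every g that is not a root modulo p of the
    polynomial with coefficients k_j, so at most d values of g survive and the
    character sum is at most d/p; on the other hand at most ln |k_j| / ln m of
    the primes divide a given k_j <> 0, while by Chebyshev there are about
    m / ln m primes.  Hence the rule integrates e_k with error O(d r_3(k) / m).

    Passing from exponentials to f needs no Fourier inversion theorem: the nodes
    are shifted into the open cube, where f is the limit of its convolutions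
    with the normalised kernels prod_j (2 cos (pi t_j))^(2N).  These are
    trigonometric polynomials with nonnegative coefficients dominated by the
    constant one, so the error on each convolution is bounded by the norm of f. *)
Require Import Defs.
From mathcomp Require Import all_boot all_order all_algebra.
From mathcomp Require Import all_classical all_reals all_analysis.
From mathcomp Require Import measurable_realfun complex zify ring lra.

Set Implicit Arguments.
Unset Strict Implicit.
Unset Printing Implicit Defensive.
Import Order.TTheory GRing.Theory Num.Theory.
Import numFieldNormedType.Exports.

(** * Primes in (m, 4m] *)

(** Moving down from the centre, consecutive coefficients have ratio at most one, and symmetry
    covers the upper half. This serves the prime estimates and also the domination of kernel
    coefficients by the constant one. *)
Lemma bin_le_central N m : 'C(N.*2, m) <= 'C(N.*2, N).
Proof.
have below k : k <= N -> 'C(N.*2, N - k) <= 'C(N.*2, N).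
  elim: k => [|k IHk] kN; first by rewrite subn0.
  apply: leq_trans (IHk (ltnW kN)); rewrite -(subnSK kN).
  rewrite -(@leq_pmul2l (N - k.+1).+1) // mul_bin_left leq_mul2r.
  by apply/orP; right; lia.
have [mN|Nm] := leqP m N; first by rewrite -(subKn mN) below ?leq_subr.
have [m2N|] := leqP m N.*2; last by move=> ?; rewrite bin_small.
rewrite -bin_sub // (_ : N.*2 - m = N - (m - N)) ?below; lia.
Qed.

Lemma sum_bin n : \sum_(i < n.+1) 'C(n, i) = 2 ^ n.
Proof.
rewrite -[2]/(1 + 1) expnDn; apply: eq_bigr => i _.
by rewrite !exp1n !muln1.
Qed.

(** The row sums to [4 ^ N] and has [2N + 1] entries, none above the central one. *)
Lemma exp4_le_central N : 4 ^ N <= N.*2.+1 * 'C(N.*2, N).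
Proof.
rewrite -[4]/(2 ^ 2) -expnM mul2n -sum_bin.
apply: leq_trans (_ : \sum_(i < N.*2.+1) 'C(N.*2, N) <= _).
  by apply: leq_sum => i _; exact: bin_le_central.
by rewrite sum_nat_const card_ord.
Qed.

Lemma prod_primes_dvd (s : seq nat) N : uniq s -> all prime s ->
  all (dvdn^~ N) s -> \prod_(p <- s) p %| N.
Proof.
elim: s => [|p s IHs] /=; first by rewrite big_nil dvd1n.
case/andP=> ps us /andP[pp sp] /andP[pN sN]; rewrite big_cons.
rewrite Gauss_dvd ?pN ?IHs // big_seq; elim/big_ind : _ => //.
- exact: coprimen1.
- by move=> x y px py; rewrite coprimeMr px.
- move=> q qs; rewrite prime_coprime // dvdn_prime2 //; last exact: (allP sp).
  by apply: contra ps => /eqP->.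
Qed.

Lemma prime_ndvd_fact p j : prime p -> j < p -> ~~ (p %| j `!).
Proof.
move=> pp; elim: j => [|j IHj] jp; first by rewrite fact0 gtnNdvd ?prime_gt1.
by rewrite factS Euclid_dvdM // negb_or gtnNdvd //= IHj // ltnW.
Qed.

(** The two middle coefficients of the row [2k + 1] are equal and both occur in its sum
    [2 ^ (2k + 1)]. *)
Lemma bin_odd_le k : 'C(k.*2.+1, k) <= 4 ^ k.
Proof.
have h : k <= k.*2.+1 by lia.
rewrite -(@leq_pmul2l 2) // -[4]/(2 ^ 2) -expnM -expnS (mul2n k) -sum_bin.
have k1 : k.+1 < k.*2.+2 by lia.
rewrite (bigD1 (Ordinal (ltnW k1))) //= (bigD1 (Ordinal k1)) /=; last first.
  by apply/negP => /eqP /(congr1 val) /=; lia.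
rewrite -[X in _ + (X + _)]bin_sub ?(ltnW k1) //.
rewrite (_ : k.*2.+1 - k.+1 = k); last by lia.
by rewrite addnA mul2n -addnn leq_addr.
Qed.

(** Strong induction. An even number above 2 adds no prime. For [2k + 1], the primes up to [k + 1]
    fall under the induction hypothesis, and those in [(k + 1, 2k + 1]] all divide
    ['C(2k + 1, k)]. *)
Lemma primorial_le n : \prod_(0 <= p < n.+1 | prime p) p <= 4 ^ n.
Proof.
elim/ltn_ind : n => -[|[|n]] IH.
- by rewrite unlock.
- by rewrite unlock.
(* The even prime 2 is the one value outside both inductive cases. *)
have [n0|n0] := posnP n.
  by rewrite n0 unlock.
case: (boolP (odd n)) => on; last first.
  rewrite big_mkcond big_nat_recr //= -big_mkcond.
  have /negbTE-> : ~~ prime n.+2.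
    apply/negP => /even_prime [|]; first by lia.
    by rewrite /= negbK (negbTE on).
  by rewrite muln1; apply: leq_trans (IH n.+1 _) _ => //; rewrite leq_exp2l.
have [k nE] : exists k, n.+2 = k.*2.+1.
  by exists (n.+1)./2; have := odd_double_half n.+1; rewrite /= on; lia.
rewrite nE (@big_cat_nat _ _ _ k.+2) //=; last by lia.
rewrite (_ : 4 ^ _ = 4 ^ k.+1 * 4 ^ k); last by rewrite -expnD; congr (_ ^ _); lia.
apply: leq_mul; first by apply: IH; lia.
apply: leq_trans (bin_odd_le k).
apply: dvdn_leq; first by rewrite bin_gt0; lia.
rewrite -big_filter; apply: prod_primes_dvd.
- by rewrite filter_uniq ?iota_uniq.
- exact: filter_all.
apply/allP => p; rewrite mem_filter mem_index_iota => /andP[pp /andP[kp pk]].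
have : p %| k.*2.+1 `! by rewrite dvdn_fact // prime_gt0 //=; lia.
have kk : k <= k.*2.+1 by lia.
rewrite -(bin_fact kk) Euclid_dvdM // Euclid_dvdM //.
have k1 : k.*2.+1 - k = k.+1 by lia.
by rewrite k1 (negbTE (prime_ndvd_fact pp _))
  ?(negbTE (@prime_ndvd_fact _ k.+1 pp _)) ?orbF //; lia.
Qed.

(** Legendre's formula: each power [p ^ k] contributes [2n %/ p ^ k - 2 (n %/ p ^ k)], which is 0 or
    1, and 0 once [p ^ k > 2n]. So the exponent is at most the logarithm of [2n] in base [p]. *)
Lemma pfactor_central_le p n : prime p -> 0 < n ->
  p ^ logn p 'C(n.*2, n) <= n.*2.
Proof.
move=> pp n0; have p1 := prime_gt1 pp.
apply: leq_trans (trunc_logP p1 (_ : 0 < n.*2)); last by lia.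
rewrite leq_exp2l //.
have nn : n <= n.*2 by lia.
have := congr1 (logn p) (bin_fact nn).
rewrite (_ : n.*2 - n = n); last by lia.
rewrite !lognM ?muln_gt0 ?fact_gt0 ?bin_gt0 // !logn_fact //.
(* Both Legendre sums are put on the same range; the added terms vanish because [p ^ k > n]. *)
have -> : \sum_(1 <= k < n.+1) n %/ p ^ k = \sum_(1 <= k < n.*2.+1) n %/ p ^ k.
  rewrite [RHS](@big_cat_nat _ _ _ n.+1) //= [X in _ = _ + X]big_nat_cond.
  rewrite [X in _ = _ + X]big1 ?addn0 // => i /andP[/andP[ni _] _].
  by rewrite divn_small //; apply: leq_trans (ltnW (ltn_expl i p1)); lia.
set t := trunc_log _ _ => H.
suff : \sum_(1 <= k < n.*2.+1) n.*2 %/ p ^ k <=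
    \sum_(1 <= k < n.*2.+1) n %/ p ^ k + \sum_(1 <= k < n.*2.+1) n %/ p ^ k + t.
  by rewrite -H; lia.
apply: (@leq_trans (\sum_(1 <= k < n.*2.+1) (n %/ p ^ k + n %/ p ^ k + (k <= t)))).
  apply: leq_sum => k _.
  have pk : 0 < p ^ k by rewrite expn_gt0 (ltnW p1).
  have [kt|tk] := leqP k t.
    have := divn_eq n (p ^ k); have := ltn_pmod n pk.
    set a := n %/ _; set b := n %% _ => ? ->.
    by rewrite -ltnS ltn_divLR // /=; nia.
  have : n.*2 < p ^ k.
    by apply: leq_trans (trunc_log_ltn _ p1) _; rewrite leq_exp2l.
  by move=> ?; rewrite divn_small.
rewrite !big_split /= leq_add2l.
have -> : \sum_(1 <= k < n.*2.+1) (k <= t : nat) =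
   count (fun k => k <= t) (index_iota 1 n.*2.+1).
  by rewrite -sum1_count [RHS]big_mkcond.
rewrite -size_filter -[leqRHS](size_iota 1 t); apply: uniq_leq_size.
  by rewrite filter_uniq ?iota_uniq.
by move=> k; rewrite mem_filter mem_index_iota mem_iota; lia.
Qed.

Definition primes_between m M : seq nat := [seq p <- index_iota m.+1 M.+1 | prime p].

Lemma mem_primes_between m M p :
  (p \in primes_between m M) = [&& prime p, m < p & p <= M].
Proof. by rewrite mem_filter mem_index_iota. Qed.

Lemma uniq_primes_between m M : uniq (primes_between m M).
Proof. by rewrite filter_uniq ?iota_uniq. Qed.

(** Each listed prime exceeds [m], and their product is part of the primorial of [M]. *)
Lemma exp_size_primes_between m M : m ^ size (primes_between m M) <= 4 ^ M.
Proof.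
apply: leq_trans (primorial_le M).
apply: leq_trans (_ : \prod_(p <- primes_between m M) p <= _).
  rewrite -[X in m ^ X]count_predT -iter_muln_1 -big_const_seq.
  rewrite big_seq [leqRHS]big_seq; apply: leq_prod => p.
  by rewrite mem_primes_between => /and3P[_ /ltnW].
rewrite big_filter; have [mM|Mm] := leqP m M; last first.
  by rewrite big_geq ?ltnS ?(ltnW Mm) // prodn_cond_gt0 // => p /prime_gt0.
rewrite [leqRHS](@big_cat_nat _ _ _ m.+1) //= leq_pmull //.
by rewrite prodn_cond_gt0 // => p /prime_gt0.
Qed.

(** A factorisation over a fixed range of primes, which can then be split according to the size of
    [p]. *)
Lemma prod_logn_bound n B : 0 < n -> (forall p, p \in \pi(n) -> p < B) ->
  n = \prod_(0 <= p < B | prime p) p ^ logn p n.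
Proof.
move=> n0 nB; rewrite -{1}(partnT n0) (widen_partn _ (leq_addr B n)).
rewrite (@big_cat_nat _ _ _ B) //=; last by lia.
rewrite [X in _ * X]big_nat_cond [X in _ * X]big1 ?muln1; last first.
  move=> p /andP[/andP[Bp _] _]; rewrite lognE; case: ifP => // /and3P[pp _ pn].
  have := nB p; rewrite mem_primes pp n0 pn => /(_ isT); lia.
rewrite [RHS]big_mkcond; apply: eq_bigr => p _.
by case: ifP => // pp; rewrite lognE pp.
Qed.

(* Erdős's bound on the prime factorisation of the central binomial coefficient:
   each prime power is at most 4m, and primes beyond sqrt(4m) occur at most once. *)
Lemma exp4_le_primes_between m q : 0 < m -> 4 * m < q.+1 ^ 2 ->
  4 ^ (2 * m) <=
  (4 * m).+1 * ((4 * m) ^ q * 4 ^ m * (4 * m) ^ size (primes_between m (4 * m))).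
Proof.
move=> m0 mq.
have d2 : (2 * m).*2 = 4 * m by lia.
apply: leq_trans (exp4_le_central _) _; rewrite d2 leq_mul2l; apply/orP; right.
set b := 'C(4 * m, 2 * m).
have b0 : 0 < b by rewrite bin_gt0; lia.
have bB p : p \in \pi(b) -> p < (4 * m).+1.
  rewrite mem_primes ltnS => /and3P[pp _ pb]; rewrite leqNgt; apply/negP => mp.
  have h : 2 * m <= 4 * m by lia.
  by have := prime_ndvd_fact pp mp; rewrite -(bin_fact h) dvdn_mulr.
rewrite {1}(prod_logn_bound b0 bB).
(* Three regimes, one factor each: [p <= q] contributes at most [4m]; [q < p <= m] occurs at most
   once, since [p ^ 2 > 4m], and is absorbed by the primorial of [m]; [p > m] contributes at most
   [4m]. *)
apply: leq_trans (_ : \prod_(0 <= p < (4 * m).+1 | prime p)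
   ((if p <= q then 4 * m else 1) * (if p <= m then p else 1) *
   (if m < p then 4 * m else 1)) <= _).
  apply: leq_prod => p pp.
  have pb : p ^ logn p b <= 4 * m.
    by have := @pfactor_central_le p (2 * m) pp; rewrite d2; apply; lia.
  have p0 := prime_gt0 pp.
  have [pq|qp] := leqP p q.
    rewrite -mulnA; apply: leq_trans pb _; rewrite leq_pmulr //.
    by case: ifP => _; case: ifP => _; lia.
  rewrite mul1n; have [pm|mp] := leqP p m; last by rewrite mul1n.
  rewrite muln1 -[leqRHS]expn1 leq_exp2l ?prime_gt1 //.
  rewrite leqNgt; apply/negP => l2.
  have : p ^ 2 <= 4 * m by apply: (leq_trans _ pb); rewrite leq_exp2l // prime_gt1.
  by rewrite leqNgt => /negP; apply; apply: leq_trans mq _; rewrite leq_sqr.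
rewrite !big_split /=; apply: leq_mul; first apply: leq_mul.
- rewrite -big_mkcondr /= -big_filter big_const_seq count_predT iter_muln_1.
  rewrite leq_pexp2l //; first by lia.
  rewrite -[leqRHS](size_iota 1 q); apply: uniq_leq_size.
    by rewrite filter_uniq ?iota_uniq.
  move=> p; rewrite mem_filter mem_index_iota mem_iota => /andP[/andP[/prime_gt0]].
  by lia.
- rewrite -big_mkcondr /= (@big_cat_nat _ _ _ m.+1) //=; last by lia.
  rewrite [X in _ * X]big_nat_cond [X in _ * X]big1 ?muln1; last by lia.
  apply: leq_trans (primorial_le m).
  rewrite big_nat_cond [leqRHS]big_nat_cond; apply: eq_leq; apply: eq_bigl => p.
  by rewrite ltnS; case: (leqP p m); rewrite ?andbT ?andbF.
- rewrite -big_mkcondr /= (@big_cat_nat _ _ _ m.+1) //=; last by lia.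
  rewrite big_nat_cond big1 ?mul1n; last by lia.
  rewrite /primes_between size_filter -iter_muln_1 -big_const_seq.
  rewrite big_nat_cond [leqRHS]big_nat_cond; apply: eq_leq; apply: eq_bigl => p.
  by rewrite ltnS; case: (leqP p m) => ?; rewrite ?andbT ?andbF.
Qed.

Local Open Scope classical_set_scope.
Local Open Scope ring_scope.

Local Notation normc := ComplexField.Normc.normc.
Local Notation Re := complex.Re.

(** * Chebyshev bounds in logarithmic form *)

Section chebyshev.
Context {R : realType}.

Lemma ln_nat_le (a b : nat) : (0 < a <= b)%N -> ln (a%:R : R) <= ln b%:R.
Proof.
by case/andP=> a0 ab; rewrite ler_ln ?posrE ?ltr0n ?ler_nat //; apply: leq_trans ab.
Qed.

Lemma ln_natM (a b : nat) : (0 < a)%N -> (0 < b)%N ->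
  ln ((a * b)%N%:R : R) = ln a%:R + ln b%:R.
Proof. by move=> a0 b0; rewrite natrM lnM ?posrE ?ltr0n. Qed.

Lemma ln_natX (a b : nat) : (0 < a)%N -> ln ((a ^ b)%N%:R : R) = b%:R * ln a%:R.
Proof. by move=> a0; rewrite natrX lnXn ?ltr0n // mulr_natl. Qed.

Lemma ln4_ge1 : 1 <= ln (4 : R).
Proof.
have h : ln (2^-1 : R) <= - 2^-1.
  have := @le_ln1Dx R (- 2^-1); rewrite (_ : 1 - 2^-1 = 2^-1); last by field.
  by apply; lra.
have -> : ln (4 : R) = - (ln (2^-1) *+ 2).
  by rewrite -lnXn ?invr_gt0 // -lnV ?posrE ?exprn_gt0 ?invr_gt0 //; congr ln; field.
lra.
Qed.

Lemma ln4_le2 : ln (4 : R) <= 2.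
Proof.
have h : ln (2 : R) <= 1 by have := @le_ln1Dx R 1; apply; lra.
have -> : ln (4 : R) = ln 2 *+ 2 by rewrite -lnXn //; congr ln; ring.
lra.
Qed.

Lemma size_primes_between_le m M : (0 < m)%N ->
  (size (primes_between m M))%:R * ln (m%:R : R) <= 2 * M%:R.
Proof.
move=> m0; have := @ln_nat_le (m ^ size (primes_between m M)) (4 ^ M).
rewrite expn_gt0 m0 exp_size_primes_between => /(_ isT).
rewrite !ln_natX // => /le_trans; apply.
by rewrite mulrC ler_wpM2r // ln4_le2.
Qed.

(** Logarithm of [exp4_le_primes_between]: the small primes cost at most [m / 2], which leaves
    [m / 2 <= 2 s ln m]. *)
Lemma size_primes_between_ge m : (20 ^+ 4 <= m%:R :> R) ->
  m%:R / 4 <= (size (primes_between m (4 * m)))%:R * ln (m%:R : R).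
Proof.
move=> mbig; set s := size _.
have mpos : (0 < m%:R :> R) by apply: lt_le_trans mbig; rewrite exprn_gt0.
have m0 : (0 < m)%N by rewrite -(ltr0n R).
(* With the fourth root, [ln m <= 4 (u - 1)], so [sqrt m * ln m] is of order [u ^ 3]; the threshold
   [u >= 20] puts the whole small-prime term below [u ^ 4 / 2]. *)
set u := Num.sqrt (Num.sqrt (m%:R : R)).
have u4 : u ^+ 4 = m%:R.
  by rewrite (exprM _ 2 2) sqr_sqrtr ?sqrtr_ge0 // sqr_sqrtr // ltW.
have u0 : 0 <= u by rewrite sqrtr_ge0.
have u20 : 20 <= u.
  rewrite leNgt; apply/negP => u20.
  suff : u ^+ 4 < 20 ^+ 4 by rewrite u4 ltNge mbig.
  by rewrite ltrXn2r.
(* The integer part of [sqrt (4m)]. *)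
pose q := Num.trunc (2 * u ^+ 2).
have /andP[q1 q2] : q%:R <= 2 * u ^+ 2 < q.+1%:R.
  by apply: truncn_itv; rewrite mulr_ge0 ?sqr_ge0.
have mq : (4 * m < q.+1 ^ 2)%N.
  rewrite -(ltr_nat R) natrX natrM -u4.
  have -> : 4%:R * u ^+ 4 = (2 * u ^+ 2) ^+ 2 by ring.
  by rewrite ltrXn2r // mulr_ge0 ?sqr_ge0.
have := exp4_le_primes_between m0 mq; rewrite -/s => H.
have {H} := @ln_nat_le _ _ (introT andP (conj _ H)).
rewrite expn_gt0 => /(_ isT).
have m40 : (0 < 4 * m)%N by lia.
have pw a b : (0 < a)%N -> (0 < a ^ b)%N by rewrite expn_gt0 => ->.
rewrite !ln_natM ?muln_gt0 ?pw // !ln_natX // natrM.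
have h1 : ln ((4 * m).+1%:R : R) <= 2 * ln (4 * m)%N%:R.
  rewrite -ln_natX //; apply: ln_nat_le.
  by rewrite ltn0Sn -mulnn /=; nia.
rewrite ln_natM // in h1 *.
set l4 := ln 4%:R in h1 *; set lm := ln m%:R in h1 *.
have l41 : 1 <= l4 := ln4_ge1.
have l42 : l4 <= 2 := ln4_le2.
have lmu : lm <= 4 * (u - 1).
  rewrite /lm -u4 lnXn; last by lra.
  have := @le_ln1Dx R (u - 1); rewrite (_ : 1 + (u - 1) = u); last by ring.
  move=> h; have {}h : ln u <= u - 1 by apply: h; lra.
  by rewrite -[ln u *+ 4]mulr_natl; lra.
have l4m : l4 <= lm by apply: ln_nat_le; rewrite /= -(ler_nat R); lra.
have qu : (q%:R + 2) * (l4 + lm) <= (2 * u ^+ 2 + 2) * (4 * u).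
  by apply: ler_pM; rewrite ?addr_ge0 //; lra.
have uu : (2 * u ^+ 2 + 2) * (4 * u) <= u ^+ 4 / 2.
  have -> : u ^+ 4 / 2 = u * (u * (u * u) / 2) by field.
  have -> : (2 * u ^+ 2 + 2) * (4 * u) = u * (8 * (u * u) + 8) by ring.
  by rewrite ler_wpM2l //; nra.
have s0 : 0 <= s%:R :> R by [].
have sl : s%:R * (l4 + lm) <= s%:R * (2 * lm) by rewrite ler_wpM2l //; lra.
rewrite u4 in uu.
have ml : m%:R <= m%:R * l4 by rewrite ler_peMr // ltW.
lra.
Qed.
End chebyshev.

(** * Trigonometric kernel *)

Section expi.
Context {R : realType}.
Implicit Types (x y z : R[i]) (t u : R).

Lemma ReD x y : Re (x + y) = Re x + Re y.
Proof. by case: x y => [? ?] [? ?]. Qed.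

Lemma ReZ t x : Re (t%:C%C * x) = t * Re x.
Proof. by case: x => a b /=; ring. Qed.

Lemma Re_sum I (s : seq I) (P : pred I) (F : I -> R[i]) :
  Re (\sum_(i <- s | P i) F i) = \sum_(i <- s | P i) Re (F i).
Proof. by apply: (big_morph (@complex.Re R) ReD). Qed.

Lemma le_normc_sum I (s : seq I) (P : pred I) (F : I -> R[i]) :
  normc (\sum_(i <- s | P i) F i) <= \sum_(i <- s | P i) normc (F i).
Proof.
elim/big_rec2 : _ => [|i a b _ h]; first by rewrite ComplexField.Normc.normc0.
by apply: le_trans (le_normcD _ _) _; rewrite lerD2l.
Qed.

Lemma normc_real t : normc t%:C%C = `|t|.
Proof. by rewrite /= expr0n addr0 sqrtr_sqr. Qed.

Lemma normc_ge0 x : 0 <= normc x.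
Proof. by case: x => a b; exact: sqrtr_ge0. Qed.

Lemma normr_Re_le x : `|Re x| <= normc x.
Proof.
case: x => a b /=; rewrite -sqrtr_sqr ler_wsqrtr // lerDl; exact: sqr_ge0.
Qed.

Lemma expiD t u : expi (t + u) = expi t * expi u.
Proof. by rewrite /expi cosD sinD; apply/eqP; rewrite eq_complex /= [sin t * _ + _]addrC !eqxx. Qed.

Lemma expi0 : expi 0 = 1 :> R[i].
Proof. by rewrite /expi cos0 sin0. Qed.

Lemma expiMn t n : expi (n%:R * t) = expi t ^+ n.
Proof.
elim: n => [|n IHn]; first by rewrite mul0r expi0.
by rewrite exprS -IHn -expiD -natr1; congr expi; ring.
Qed.

Lemma expi_sum I (s : seq I) (P : pred I) (F : I -> R) :
  expi (\sum_(i <- s | P i) F i) = \prod_(i <- s | P i) expi (F i).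
Proof. exact: (big_morph (@expi R) expiD expi0). Qed.

Lemma normc_expi t : normc (expi t) = 1.
Proof. by rewrite /= cos2Dsin2 sqrtr1. Qed.

Lemma expi_2pi_nat n : expi (2 * pi * n%:R) = 1 :> R[i].
Proof.
rewrite mulrC expiMn (_ : expi (2 * pi) = 1) ?expr1n //.
by rewrite mulr_natl /expi cos2pi sin2pi.
Qed.

Lemma expi_2pi_int (n : int) : expi (2 * pi * n%:~R) = 1 :> R[i].
Proof.
case: n => n; first exact: expi_2pi_nat.
rewrite NegzE mulrNz mulrN.
have := expiD (2 * pi * n.+1%:R) (- (2 * pi * n.+1%:R)).
by rewrite subrr expi0 expi_2pi_nat mul1r => <-.
Qed.

Lemma expi_neq1 t : 0 < t < 1 -> expi (2 * pi * t) != 1.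
Proof.
case/andP=> t0 t1; apply/negP => /eqP /(congr1 (@complex.Re R)) /=.
have st : 0 < sin (pi * t).
  by apply: sin_gt0_pi; rewrite mulr_gt0 ?pi_gt0 //= gtr_pMr ?pi_gt0.
have -> : 2 * pi * t = (pi * t) *+ 2 by ring.
rewrite cos_mulr2n cos2sin2 => h.
by have : 0 < sin (pi * t) ^+ 2; [rewrite exprn_gt0|lra].
Qed.

(** A geometric sum in [w], with [w ^ p = 1]. If [p] does not divide [a], the residue of [a] over
    [p] lies strictly between 0 and 1, so [w] differs from 1 and the sum vanishes. *)
Lemma sum_expi_char (p : nat) (a : int) : (0 < p)%N ->
  \sum_(h < p) expi (2 * pi * (h%:R * a%:~R / p%:R)) =
  (if (p %| a)%Z then p%:R else 0) :> R[i].
Proof.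
move=> p0; have pN0 : p%:R != 0 :> R by rewrite pnatr_eq0 -lt0n.
set w : R[i] := expi (2 * pi * (a%:~R / p%:R)).
have -> : \sum_(h < p) expi (2 * pi * (h%:R * a%:~R / p%:R)) = \sum_(h < p) w ^+ h.
  by apply: eq_bigr => h _; rewrite -expiMn; congr expi; ring.
have [/dvdzP[q aE]|pa] := ifPn.
  have -> : w = 1.
    by rewrite /w aE intrM -[(p : int)%:~R]pmulrn mulfK // expi_2pi_int.
  under eq_bigr do rewrite expr1n.
  by rewrite sumr_const card_ord.
have wp : w ^+ p = 1.
  rewrite -expiMn (_ : _ * _ = 2 * pi * a%:~R) ?expi_2pi_int //.
  by field.
have w1 : w != 1.
  have aE : a%:~R / p%:R = (a %/ p)%Z%:~R + (a %% p)%Z%:~R / p%:R :> R.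
    by rewrite {1}(divz_eq a p) intrD intrM pmulrn mulrDl mulfK // -pmulrn.
  rewrite /w aE mulrDr expiD.
  rewrite expi_2pi_int mul1r expi_neq1 //.
  have [m mE] : exists m : nat, (a %% p)%Z = m.
    by exists `|(a %% p)%Z|%N; rewrite gez0_abs // modz_ge0 // -lt0n.
  have mp : (m < p)%N by rewrite -ltz_nat -mE ltz_pmod.
  have m0 : (0 < m)%N.
    by rewrite lt0n -eqz_nat -mE; apply: contra pa => /eqP h; apply/dvdz_mod0P.
  rewrite mE -pmulrn divr_gt0 ?ltr0n //=.
  by rewrite ltr_pdivrMr ?ltr0n // mul1r ltr_nat.
have := subrX1 w p; rewrite wp subrr => /esym/eqP.
by rewrite mulf_eq0 subr_eq0 (negbTE w1) => /eqP.
Qed.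

End expi.

(** * The cosine-power kernel and its Fourier expansion *)

Section fejer.
Context {R : realType}.

(** The even exponent makes each factor nonnegative and of period 1, although [cos (pi t)] changes
    sign under [t + 1]. *)
Definition cos_kernel d N (t : 'rV[R]_d) : R :=
  \prod_(j < d) (2 * cos (pi * t ord0 j)) ^+ (N.*2).

(** Binomial indices in [[0, 2N]] are recentred to frequencies in [[-N, N]]; the central index gives
    frequency zero. *)
Definition freq d N (m : {ffun 'I_d -> 'I_(N.*2).+1}) : 'rV[int]_d :=
  \row_j (N%:Z - (m j)%:Z).

Lemma freq_inj d N : injective (@freq d N).
Proof.
move=> m n /rowP h; apply/ffunP => j; apply/val_inj.
by have := h j; rewrite !mxE => /addrI /oppr_inj [].
Qed.

Definition cos_kernel_coef d N (m : {ffun 'I_d -> 'I_(N.*2).+1}) : R :=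
  (\prod_(j < d) 'C(N.*2, m j))%N%:R.

(** Euler's formula and the binomial theorem: the term [i] has phase [pi t (2N - i) - pi t i]. *)
Lemma expr_2cos N (t : R) :
  (((2 * cos (pi * t)) ^+ (N.*2))%:C)%C =
  \sum_(i < (N.*2).+1) ('C(N.*2, i)%:R%:C)%C * expi (2 * pi * ((N%:Z - i%:Z)%:~R * t)).
Proof.
have -> : ((2 * cos (pi * t)) ^+ (N.*2))%:C%C =
    (expi (pi * t) + expi (- (pi * t))) ^+ N.*2.
  rewrite rmorphXn /=; congr (_ ^+ _); rewrite /expi cosN sinN.
  by apply/eqP; rewrite eq_complex /= subrr -mulr2n mulr_natl !eqxx.
rewrite exprDn; apply: eq_bigr => i _.
rewrite -!expiMn -expiD rmorph_nat -[LHS]mulr_natl; congr (_ * expi _).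
have iN : (i <= N.*2)%N by rewrite -ltnS.
have N2 : (N.*2)%:R = 2 * N%:R :> R by rewrite -natrM mul2n.
by rewrite natrB // intrB -!pmulrn N2; ring.
Qed.

Lemma cos_kernelE d N (t : 'rV[R]_d) : cos_kernel N t =
  \sum_(m : {ffun 'I_d -> 'I_(N.*2).+1})
     cos_kernel_coef m * Re (expi (2 * pi * dotZ (freq m) t)).
Proof.
transitivity (Re ((cos_kernel N t)%:C)%C); first by [].
rewrite /cos_kernel rmorph_prod /=.
under eq_bigr do rewrite expr_2cos.
rewrite bigA_distr_bigA Re_sum; apply: eq_bigr => m _.
rewrite big_split -rmorph_prod ReZ.
rewrite -[cos _]/(Re (expi (2 * pi * dotZ (freq m) t))); congr (_ * Re _).
  by rewrite /cos_kernel_coef natr_prod.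
rewrite -expi_sum -mulr_sumr; congr (expi (_ * _)).
by apply: eq_bigr => j _; rewrite mxE.
Qed.

Lemma cos_kernel_ge0 d N (t : 'rV[R]_d) : 0 <= cos_kernel N t.
Proof. by apply: prodr_ge0 => j _; rewrite -mul2n exprM exprn_ge0 // sqr_ge0. Qed.

End fejer.

(** * Fourier coefficients and mollification on the cube *)

Section cube.
Context {R : realType}.

Lemma measurable_cos_comp d (T : measurableType d) (D : set T) (f : T -> R) :
  measurable_fun D f -> measurable_fun D (fun x => cos (f x)).
Proof.
move=> mf; apply: (@measurableT_comp _ _ _ _ _ _ (@cos R)) => //.
apply: continuous_measurable_fun; exact: continuous_cos.
Qed.

Lemma measurable_dotZ d (k : 'rV[int]_d) :
  measurable_fun [set: 'rV[R]_d] (dotZ k).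
Proof.
apply: measurable_sum => j; apply: measurable_funM => //.
exact: measurable_coord.
Qed.

(** For [n != 0] the antiderivative takes equal values at 0 and 1. The free phase [a] absorbs the
    other coordinates in the induction on the dimension. *)
Lemma integral_cos_itv (n : int) (a : R) :
  (\int[lebesgue_measure]_(x in `[0%R, 1%R[) (cos (2 * pi * (n%:~R * x) + a))%:E =
   (if n == 0 then cos a else 0)%:E)%E.
Proof.
have [->|n0] := eqVneq n 0.
  under eq_integral do rewrite mul0r mulr0 add0r.
  rewrite integral_cst //= lebesgue_measure_itv /= lte_fin ltr01.
  by rewrite -EFinB subr0 mule1.
pose w : R := 2 * pi * n%:~R.
have w0 : w != 0 by rewrite !mulf_neq0 ?intr_eq0 // gt_eqF ?pi_gt0.
have -> : (fun x : R => (cos (2 * pi * (n%:~R * x) + a))%:E) =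
          (fun x => (cos (w * x + a))%:E).
  by apply/funext => x; rewrite mulrA.
have dlin x : is_derive x (1 : R) (fun x : R => w * x + a) w.
  by apply: is_derive_eq; rewrite addr0 [LHS]mulr1.
have cf : continuous (fun x : R => cos (w * x + a)).
  move=> x; apply: (@continuous_comp _ _ _ (fun x : R => w * x + a) (@cos R)).
    by apply/differentiable_continuous/derivable1_diffP; case: (dlin x).
  exact: continuous_cos.
rewrite integral_itv_bndo_bndc; last first.
  apply/measurable_EFinP; apply: measurable_funS measurableT _ _ => //.
  exact: continuous_measurable_fun.
have dF x : is_derive x (1 : R) (fun x : R => w^-1 * sin (w * x + a)) (cos (w * x + a)).
  apply: is_derive_eq.
  by rewrite /GRing.scale /= mulrCA mulVf ?mulr1.
have cF : continuous (fun x : R => w^-1 * sin (w * x + a)).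
  by move=> x; apply/differentiable_continuous/derivable1_diffP; case: (dF x).
rewrite (@continuous_FTC2 _ _ (fun x : R => w^-1 * sin (w * x + a))) //.
- have [_ sE] : expi (w + a) = expi a by rewrite expiD expi_2pi_int mul1r.
  by rewrite -EFinB mulr1 mulr0 add0r sE subrr.
- exact: continuous_subspaceT.
- split.
  + by move=> x _; case: (dF x).
  + by apply: cvg_at_right_filter; exact: cF.
  + by apply: cvg_at_left_filter; exact: cF.
- by move=> x _; rewrite derive1E; apply: derive_val.
Qed.

Lemma dotZ_cons d (k : 'rV[int]_d.+1) (p : R * 'rV[R]_d) :
  dotZ k (rV_cons p) = (k ord0 ord0)%:~R * p.1 + dotZ (\row_j k ord0 (lift ord0 j)) p.2.
Proof.
rewrite /dotZ big_ord_recl rV_cons0; congr (_ + _).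
by apply: eq_bigr => j _; rewrite rV_consS mxE.
Qed.

Lemma integral_cos_cube d (k : 'rV[int]_d) (a : R) :
  (\int[lebesgue_rV d]_(x in unit_cube d) (cos (2 * pi * dotZ k x + a))%:E =
   (if k == 0%R then cos a else 0)%:E)%E.
Proof.
elim: d => [|d IHd] in k a *.
  rewrite (_ : k == 0); last by apply/eqP/rowP; case.
  under eq_integral do rewrite /dotZ big_ord0 mulr0 add0r.
  have mB0 := @measurable_unit_cube R 0.
  by rewrite integral_cst // [X in (_ * X)%E](lebesgue_rV_unit_cube 0) mule1.
have mf : measurable_fun [set: 'rV[R]_d.+1] (fun x => cos (2 * pi * dotZ k x + a)).
  apply: measurable_cos_comp; apply: measurable_funD => //.
  by apply: measurable_funM => //; exact: measurable_dotZ.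
have mB := @measurable_unit_cube R d.
have preE : @rV_cons R d @^-1` unit_cube d.+1 = `[0%R, 1%R[ `*` @unit_cube R d.
  apply/seteqP; split=> -[b x] /= => [h|[ha h] j].
  - split; first by have := h ord0; rewrite rV_cons0 in_itv.
    by move=> j; have := h (lift ord0 j); rewrite rV_consS.
  - by case: (unliftP ord0 j) => [i ->|->]; rewrite ?rV_consS ?rV_cons0 //; exact: h.
have mI : measurable (`[(0 : R), 1[%classic : set (measurableTypeR R)).
  exact: measurable_itv.
have mAB : measurable ((`[(0 : R), 1[%classic : set (measurableTypeR R)) `*` @unit_cube R d).
  exact: measurableX.
pose f (p : measurableTypeR R * 'rV[R]_d) := cos (2 * pi * dotZ k (rV_cons p) + a).
have mfc : measurable_fun setT f.
  by apply: (@measurableT_comp _ _ _ _ _ _ _ _ _ mf); exact: measurable_rV_cons.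
have intf : (lebesgue_measure \x lebesgue_rV d)%E.-integrable
    (`[0%R, 1%R[ `*` @unit_cube R d) (EFin \o f).
  apply: measurable_bounded_integrable => //.
  - rewrite -preE; have : (lebesgue_rV d.+1 (@unit_cube R d.+1) < +oo)%E; last by [].
    by rewrite lebesgue_rV_unit_cube ltry.
  - exact: measurable_funTS.
  - by exists 1; split => // M M1 p _; apply: le_trans (ltW M1); exact: cos_max.
(* The measure in dimension [d + 1] is a pushforward, so the integral is moved back to the product,
   where Fubini applies. *)
transitivity (\int[(lebesgue_measure \x lebesgue_rV d)%E]_(p in
    `[0%R, 1%R[ `*` @unit_cube R d) (f p)%:E)%E.
  rewrite -preE; apply: integral_pushforward => //.
  - exact: measurable_rV_cons.
  - exact/measurable_EFinP.
  - by rewrite preE.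
  - exact: measurable_unit_cube.
rewrite integral_mkcond -integral21_prod_meas1; last exact/(integrable_mkcond _ mAB).
(* The first coordinate is integrated with the tail [x] fixed; the tail only shifts the phase. *)
transitivity (\int[lebesgue_rV d]_(x in unit_cube d) (if k ord0 ord0 == 0 then
    (cos (2 * pi * dotZ (\row_j k ord0 (lift ord0 j)) x + a)) else 0)%:E)%E.
  rewrite [RHS]integral_mkcond; apply: eq_integral => x _.
  rewrite /fubini_G /patch; case: ifPn => xB; last first.
    apply: integral0_eq => b _; rewrite ifF //; apply/negbTE.
    by apply: contra xB; rewrite !inE => -[].
  rewrite -integral_cos_itv [RHS]integral_mkcond; apply: eq_integral => b _.
  rewrite /patch (_ : ((b, x) \in _) = (b \in `[0%R, 1%R[%classic)); last first.
    apply/idP/idP; rewrite !inE; first by case.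
    by move=> hb; split=> //; exact: set_mem xB.
  by case: ifP => // _; rewrite /f dotZ_cons /= mulrDr addrA.
have kE : (k == 0) = (k ord0 ord0 == 0) && (\row_j k ord0 (lift ord0 j) == 0).
  apply/eqP/andP => [->|[/eqP k0 /eqP/rowP kS]].
    by rewrite mxE; split=> //; apply/eqP/rowP => j; rewrite !mxE.
  apply/rowP => j; rewrite mxE; case: (unliftP ord0 j) => [i ->|->] //.
  by have := kS i; rewrite !mxE.
rewrite kE; case: eqP => _ /=; first exact: IHd.
by rewrite integral0.
Qed.
End cube.

(** * Convolution with the kernel as a weighted Fourier sum *)

Section mollifier.
Context {R : realType}.

Local Notation mu d := (@lebesgue_rV R d).
Local Notation cube d := (@unit_cube R d).

Lemma integrable_mul_bounded d (f h : 'rV[R]_d -> R) (M : R) :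
  (mu d).-integrable (cube d) (EFin \o f) -> measurable_fun setT h ->
  (forall y, `|h y| <= M) ->
  (mu d).-integrable (cube d) (EFin \o (fun y => f y * h y)).
Proof.
move=> fi mh hM.
have -> : EFin \o (fun y => f y * h y) = ((EFin \o f) \* (EFin \o h))%E.
  by apply/funext => y /=; rewrite EFinM.
apply: integrableMl => //; first exact: measurable_unit_cube.
  exact: measurable_funTS.
exists M; split; first exact: num_real.
by move=> N MN y _; apply: le_trans (hM y) (ltW MN).
Qed.

Lemma integrable_cst_cube d (a : R) :
  (mu d).-integrable (cube d) (EFin \o (fun=> a)).
Proof.
apply: measurable_bounded_integrable => //; first exact: measurable_unit_cube.
- by have := ltry (1 : R); rewrite -(@lebesgue_rV_unit_cube R d).
- exact: bounded_cst.
Qed.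

Lemma Rintegral_sum d I (s : seq I) (F : I -> 'rV[R]_d -> R) :
  (forall i, (mu d).-integrable (cube d) (EFin \o F i)) ->
  Rintegral (mu d) (cube d) (fun y => \sum_(i <- s) F i y) =
  \sum_(i <- s) Rintegral (mu d) (cube d) (F i).
Proof.
move=> Fi; elim: s => [|i s IHs].
  under eq_Rintegral do rewrite big_nil.
  by rewrite Rintegral_cst ?mul0r ?big_nil //; exact: measurable_unit_cube.
under eq_Rintegral do rewrite big_cons.
rewrite RintegralD ?IHs ?big_cons //; first exact: measurable_unit_cube.
have -> : EFin \o (fun y => \sum_(j <- s) F j y) =
    (fun y => \sum_(j <- s) (EFin \o F j) y)%E.
  by apply/funext => y /=; rewrite sumEFin.
by apply: integrable_sum => //; exact: measurable_unit_cube.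
Qed.

Lemma dotZB d (k : 'rV[int]_d) (x y : 'rV[R]_d) : dotZ k (x - y) = dotZ k x - dotZ k y.
Proof.
by rewrite /dotZ -sumrB; apply: eq_bigr => j _; rewrite !mxE mulrBr.
Qed.

Lemma measurable_sin_comp d (T : measurableType d) (D : set T) (f : T -> R) :
  measurable_fun D f -> measurable_fun D (fun x => sin (f x)).
Proof.
move=> mf; apply: (@measurableT_comp _ _ _ _ _ _ (@sin R)) => //.
apply: continuous_measurable_fun; exact: continuous_sin.
Qed.

Lemma measurable_phase d (k : 'rV[int]_d) :
  measurable_fun [set: 'rV[R]_d] (fun y => - (2 * pi * dotZ k y)).
Proof.
apply: (@measurableT_comp _ _ _ _ _ _ (@GRing.opp R)) => //.
by apply: measurable_funM => //; exact: measurable_dotZ.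
Qed.

(** The factor depending on [x] leaves the integral: by the addition formula the integrand is
    [cos a * C - sin a * S], with [C] and [S] the two parts that define the coefficient. *)
Lemma Rintegral_mul_expi d (f : 'rV[R]_d -> R) (k : 'rV[int]_d) (x : 'rV[R]_d) :
  (mu d).-integrable (cube d) (EFin \o f) ->
  Rintegral (mu d) (cube d)
    (fun y => f y * Re (expi (2 * pi * dotZ k (x - y)))) =
  Re (expi (2 * pi * dotZ k x) * fourier_coef f k).
Proof.
move=> fi; have mD := @measurable_unit_cube R d.
rewrite /fourier_coef /complex_integral.
set C := fun y => Re _; set S := fun y => complex.Im _.
have CE : C = (fun y => f y * cos (- (2 * pi * dotZ k y))).
  by apply/funext => y; rewrite /C /= mul0r subr0.
have SE : S = (fun y => f y * sin (- (2 * pi * dotZ k y))).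
  by apply/funext => y; rewrite /S /= mul0r addr0.
have Ci : (mu d).-integrable (cube d) (EFin \o C).
  rewrite CE; apply: (integrable_mul_bounded (M := 1)) => //.
    by apply: measurable_cos_comp; exact: measurable_phase.
  by move=> y; exact: cos_max.
have Si : (mu d).-integrable (cube d) (EFin \o S).
  rewrite SE; apply: (integrable_mul_bounded (M := 1)) => //.
    by apply: measurable_sin_comp; exact: measurable_phase.
  by move=> y; exact: sin_max.
set a := 2 * pi * dotZ k x.
transitivity (Rintegral (mu d) (cube d) (fun y => cos a * C y - sin a * S y)).
  apply: eq_Rintegral => y _; rewrite CE SE /= dotZB mulrBr -/a cosB cosN sinN; ring.
rewrite RintegralB ?RintegralZl //.
- exact: (@integrableZl _ _ _ _ _ mD (cos a) (EFin \o C) Ci).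
- exact: (@integrableZl _ _ _ _ _ mD (sin a) (EFin \o S) Si).
Qed.

Lemma dotZ0 d (y : 'rV[R]_d) : dotZ 0 y = 0.
Proof. by apply: big1 => j _; rewrite mxE mul0r. Qed.

(** A convolution on the torus, by periodicity of the kernel. It is left unnormalised; the division
    by [cos_kernel_mass] comes in the limit. *)
Definition mollify d N (f : 'rV[R]_d -> R) (x : 'rV[R]_d) : R :=
  Rintegral (mu d) (cube d) (fun y => f y * cos_kernel N (x - y)).

Lemma measurable_cos_dotZ d (k : 'rV[int]_d) (x : 'rV[R]_d) :
  measurable_fun [set: 'rV[R]_d] (fun y => cos (2 * pi * dotZ k (x - y))).
Proof.
have -> : (fun y => cos (2 * pi * dotZ k (x - y))) =
    (fun y : 'rV[R]_d => cos (2 * pi * dotZ k x + - (2 * pi * dotZ k y))).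
  by apply/funext => y; rewrite dotZB mulrBr.
by apply: measurable_cos_comp; apply: measurable_funD => //; exact: measurable_phase.
Qed.

Lemma mollifyE d N (f : 'rV[R]_d -> R) (x : 'rV[R]_d) :
  (mu d).-integrable (cube d) (EFin \o f) ->
  mollify N f x = \sum_(m : {ffun 'I_d -> 'I_(N.*2).+1})
    cos_kernel_coef m * Re (expi (2 * pi * dotZ (freq m) x) * fourier_coef f (freq m)).
Proof.
move=> fi; have mD := @measurable_unit_cube R d.
have ci m : (mu d).-integrable (cube d)
    (EFin \o (fun y => f y * cos (2 * pi * dotZ m (x - y)))).
  apply: (integrable_mul_bounded (M := 1)) => //.
    exact: measurable_cos_dotZ.
  by move=> y; exact: cos_max.
rewrite /mollify.
under eq_Rintegral => y _ do rewrite cos_kernelE mulr_sumr.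
rewrite Rintegral_sum => [|m]; last first.
  have -> : EFin \o (fun y => f y * (cos_kernel_coef m *
       Re (expi (2 * pi * dotZ (freq m) (x - y))))) =
    (fun y => (cos_kernel_coef m)%:E * (EFin \o (fun y =>
      (f y * cos (2 * pi * dotZ (freq m) (x - y)))%R)) y)%E.
    by apply/funext => y /=; rewrite -EFinM mulrCA.
  exact: (@integrableZl _ _ _ _ _ mD).
apply: eq_bigr => m _; rewrite -Rintegral_mul_expi // -RintegralZl //; last exact: ci.
by apply: eq_Rintegral => y _; rewrite mulrCA.
Qed.

Definition central_index d N : {ffun 'I_d -> 'I_(N.*2).+1} := [ffun=> inord N].

Lemma val_central_index d N j : central_index d N j = N :> nat.
Proof. by rewrite ffunE inordK // ltnS -addnn leq_addr. Qed.

Lemma freq_central d N : freq (central_index d N) = 0.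
Proof. by apply/rowP => j; rewrite !mxE val_central_index subrr. Qed.

Lemma freq_eq0 d N (m : {ffun 'I_d -> 'I_(N.*2).+1}) :
  (freq m == 0) = (m == central_index d N).
Proof. by rewrite -(freq_central d N) (inj_eq (@freq_inj _ _)). Qed.

(** Both the coefficient at frequency zero and the integral of the kernel over the cube. *)
Definition cos_kernel_mass d N : R := 'C(N.*2, N)%:R ^+ d.

Lemma cos_kernel_coef_central d N :
  cos_kernel_coef (central_index d N) = cos_kernel_mass d N.
Proof.
rewrite /cos_kernel_coef /cos_kernel_mass natr_prod.
under eq_bigr do rewrite val_central_index.
by rewrite prodr_const card_ord.
Qed.

Lemma cos_kernel_coef_le d N (m : {ffun 'I_d -> 'I_(N.*2).+1}) :
  0 <= (cos_kernel_coef m : R) <= cos_kernel_mass d N.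
Proof.
by rewrite -cos_kernel_coef_central /cos_kernel_coef ler0n ler_nat /=;
  apply: leq_prod => j _; rewrite val_central_index bin_le_central.
Qed.

Lemma cos_kernel_mass_gt0 d N : 0 < cos_kernel_mass d N.
Proof. by rewrite exprn_gt0 // ltr0n bin_gt0 -addnn leq_addr. Qed.

Lemma Rintegral_cos_kernel d N (x : 'rV[R]_d) :
  Rintegral (mu d) (cube d) (fun y => cos_kernel N (x - y)) = cos_kernel_mass d N.
Proof.
have mD := @measurable_unit_cube R d.
under eq_Rintegral => y _ do rewrite cos_kernelE.
have ci m : (mu d).-integrable (cube d)
    (EFin \o (fun y => cos (2 * pi * dotZ m (x - y)))).
  have -> : (fun y => cos (2 * pi * dotZ m (x - y))) =
      (fun y => 1 * cos (2 * pi * dotZ m (x - y))).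
    by apply/funext => y; rewrite mul1r.
  apply: (integrable_mul_bounded (M := 1)).
  - exact: integrable_cst_cube.
  - exact: measurable_cos_dotZ.
  - by move=> y; exact: cos_max.
rewrite Rintegral_sum => [|m]; last exact: (@integrableZl _ _ _ _ _ mD _ _ (ci (freq m))).
rewrite (bigD1 (central_index d N)) //= big1 ?addr0 => [|m mN].
  rewrite RintegralZl // freq_central cos_kernel_coef_central.
  under eq_Rintegral => y _ do rewrite dotZ0 mulr0 cos0.
  by rewrite Rintegral_cst // mul1r [X in fine X](lebesgue_rV_unit_cube d) mulr1.
rewrite RintegralZl // (_ : Rintegral _ _ _ = 0) ?mulr0 //.
rewrite /Rintegral.
under eq_integral => y _ do rewrite dotZB mulrBr -cosN opprB.
by rewrite integral_cos_cube freq_eq0 (negbTE mN).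
Qed.

End mollifier.

(** * Pointwise convergence of the mollifications at interior points *)

Section approximation.
Context {R : realType}.

Local Notation mu d := (@lebesgue_rV R d).
Local Notation cube d := (@unit_cube R d).

(** With [q = exp (- a)], the term of degree [d + 1] of the exponential series gives
    [q ^ N <= c / N ^ (d + 1)], and [2N + 1 <= 3N]; one power of [N] is left over. *)
Lemma exp_beats_poly (q : R) (d : nat) : 0 <= q < 1 ->
  exists2 C : R, 0 <= C & forall N, (0 < N)%N -> (N.*2.+1)%:R ^+ d * q ^+ N <= C / N%:R.
Proof.
case/andP=> q0 q1; have [qN|{}q0] := leP q 0.
  exists 0 => // N N0; rewrite (_ : q = 0); last by lra.
  by rewrite expr0n gtn_eqF // mulr0 mul0r.
pose a : R := - ln q.
have a0 : 0 < a by rewrite oppr_gt0 ln_lt0 ?q0.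
have qE : q = expR (- a) by rewrite opprK lnK.
pose c : R := (d.+1)`!%:R / a ^+ d.+1.
have c0 : 0 < c by rewrite divr_gt0 ?exprn_gt0 // ltr0n fact_gt0.
exists (3 ^+ d * c) => [|N N0]; first by rewrite mulr_ge0 ?exprn_ge0 // ltW.
have N0R : 0 < N%:R :> R by rewrite ltr0n.
have qN : q ^+ N <= c / N%:R ^+ d.+1.
  have h := expR_ge1Dxn d (ltW (mulr_gt0 a0 N0R)).
  have p0 : 0 < (a * N%:R) ^+ d.+1 / (d.+1)`!%:R.
    by rewrite divr_gt0 ?exprn_gt0 ?mulr_gt0 // ltr0n fact_gt0.
  have -> : c / N%:R ^+ d.+1 = ((a * N%:R) ^+ d.+1 / (d.+1)`!%:R)^-1.
    by rewrite /c exprMn invf_div invfM mulrA.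
  rewrite qE -expRM_natl mulrN expRN mulrC lef_pV2 ?posrE ?expR_gt0 //.
  by apply: le_trans h; rewrite lerDr.
have N3 : (N.*2.+1)%:R ^+ d <= (3 * N%:R) ^+ d :> R.
  by rewrite lerXn2r ?nnegrE ?mulr_ge0 // -natrM ler_nat; lia.
apply: le_trans (ler_pM _ _ N3 qN) _; rewrite ?exprn_ge0 ?(ltW q0) //.
rewrite exprMn exprS le_eqVlt; apply/orP; left; apply/eqP; field.
by rewrite expf_neq0 gt_eqF.
Qed.

Lemma cos_kernel_mass_ge d N :
  (4 ^+ N) ^+ d <= (N.*2.+1)%:R ^+ d * cos_kernel_mass d N :> R.
Proof.
rewrite /cos_kernel_mass -exprMn lerXn2r ?nnegrE ?mulr_ge0 ?exprn_ge0 //.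
by rewrite -natrX -natrM ler_nat exp4_le_central.
Qed.

(** Since the cosine decreases on [[0, pi]], [cos (pi |t|)] lies between
    [cos (pi (1 - e)) = - cos (pi e)] and [cos (pi e)]. *)
Lemma cos_sqr_le (e t : R) : 0 < e <= 2^-1 -> e <= `|t| <= 1 - e ->
  cos (pi * t) ^+ 2 <= cos (pi * e) ^+ 2.
Proof.
move=> /andP[e0 e1] /andP[t0 t1].
have pi0 := pi_gt0 R.
rewrite -(cos_norm (pi * t)) normrM gtr0_norm //.
have mono (u v : R) : 0 <= u -> u <= v -> v <= 1 -> cos (pi * v) <= cos (pi * u).
  move=> u0 uv v1; rewrite leNgt ltr_cos ?in_itv /= -?leNgt.
  - by rewrite ler_pM2l.
  - by apply/andP; split; nra.
  - by apply/andP; split; nra.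
have h1 : cos (pi * `|t|) <= cos (pi * e) by apply: mono; lra.
have h2 : - cos (pi * e) <= cos (pi * `|t|).
  have -> : - cos (pi * e) = cos (pi * (1 - e)).
    by rewrite mulrBr mulr1 addrC cosDpi cosN.
  by apply: mono; lra.
by rewrite -[leLHS]real_normK ?num_real // lerXn2r ?nnegrE // ?ler_norml ?h1 ?h2 //; lra.
Qed.

Lemma cos_sqr_lt1 (e : R) : 0 < e <= 2^-1 -> 0 <= cos (pi * e) ^+ 2 < 1.
Proof.
move=> /andP[e0 e1]; rewrite sqr_ge0 /= cos2sin2 ltrBlDr ltrDl exprn_gt0 //.
by apply: sin_gt0_pi; rewrite mulr_gt0 ?pi_gt0 //= gtr_pMr ?pi_gt0 //; lra.
Qed.

(** The coordinate [j], away from the integers, supplies the decay; every other factor is at most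
    [4 ^ N]. *)
Lemma cos_kernel_le_far d N (e : R) (t : 'rV[R]_d) (j : 'I_d) : 0 < e <= 2^-1 ->
  e <= `|t ord0 j| <= 1 - e ->
  cos_kernel N t <= (4 ^+ N) ^+ d * (cos (pi * e) ^+ 2) ^+ N.
Proof.
move=> e01 tj.
have fE u : (2 * cos (pi * u)) ^+ N.*2 = 4 ^+ N * (cos (pi * u) ^+ 2) ^+ N :> R.
  by rewrite -mul2n exprM -exprMn; congr (_ ^+ _); ring.
have nn (u : R) : 0 <= 4 ^+ N * (u ^+ 2) ^+ N.
  by rewrite mulr_ge0 // exprn_ge0 // sqr_ge0.
rewrite /cos_kernel (bigD1 j) //= fE.
have -> : (4 ^+ N) ^+ d * (cos (pi * e) ^+ 2) ^+ N =
    (4 ^+ N * (cos (pi * e) ^+ 2) ^+ N) * (4 ^+ N) ^+ d.-1 :> R.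
  have : (0 < d)%N by apply: leq_ltn_trans (ltn_ord j).
  by case: (d) => // d' _; rewrite exprS; ring.
apply: ler_pM.
- exact: nn.
- by apply: prodr_ge0 => i _; rewrite fE nn.
- rewrite ler_wpM2l ?exprn_ge0 // lerXn2r ?nnegrE ?sqr_ge0 //.
  exact: cos_sqr_le.
- have -> : (4 ^+ N) ^+ d.-1 = \prod_(i < d | i != j) (4 ^+ N : R).
    by rewrite prodr_const cardC1 card_ord.
  apply: ler_prod => i _; rewrite fE nn /=.
  rewrite ler_piMr ?exprn_ge0 // exprn_ile1 ?sqr_ge0 //.
Qed.

(** The margin [e] keeps [|x_j - y_j| <= 1 - e] for every [y] in the cube, so the periodic kernel
    does not peak again across the opposite face. *)
Definition interior_point d (e : R) (x : 'rV[R]_d) := forall j, e <= x ord0 j <= 1 - e.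

Lemma within_cube_near d (f : 'rV[R]_d -> R) x eta : {within cube d, continuous f} ->
  cube d x -> 0 < eta -> exists2 e, 0 < e &
    forall y, cube d y -> (forall j, `|x ord0 j - y ord0 j| < e) -> `|f x - f y| <= eta.
Proof.
move=> /subspace_continuousP cf Dx eta0.
have /cvgrPdist_le/(_ _ eta0) := cf x Dx.
rewrite near_withinE => /nbhs_ballP[e /= e0 he]; exists e => // y Dy xy.
by apply: he => //; split=> // i j; rewrite ord1; exact: xy.
Qed.

(** As the kernel integrates to its mass, the difference is the integral of [(f x - f y)] against
    it: continuity controls [y] near [x], and [cos_kernel_le_far] the rest. *)
Lemma mollify_dist d (f : 'rV[R]_d -> R) x e eta N : 0 <= eta ->
  (mu d).-integrable (cube d) (EFin \o f) ->
  interior_point e x -> 0 < e <= 2^-1 ->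
  (forall y, cube d y -> (forall j, `|x ord0 j - y ord0 j| < e) -> `|f x - f y| <= eta) ->
  `|cos_kernel_mass d N * f x - mollify N f x| <=
    eta * cos_kernel_mass d N +
    (`|f x| + Rintegral (mu d) (cube d) (fun y => `|f y|)) *
     ((4 ^+ N) ^+ d * (cos (pi * e) ^+ 2) ^+ N).
Proof.
move=> eta0 fi xint e01 fnear; set B := _ * _ ^+ N.
have mD := @measurable_unit_cube R d.
have [M kM] : exists M : R, forall t : 'rV[R]_d, `|cos_kernel N t| <= M.
  exists ((4 ^+ N) ^+ d) => t; rewrite ger0_norm ?cos_kernel_ge0 //.
  have -> : (4 ^+ N) ^+ d = \prod_(i < d) (4 ^+ N : R) by rewrite prodr_const card_ord.
  apply: ler_prod => i _; rewrite -mul2n exprM exprn_ge0 ?sqr_ge0 //=.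
  rewrite lerXn2r ?nnegrE ?sqr_ge0 // exprMn -natrX.
  by rewrite ler_piMr // -[_ ^+ 2]real_normK ?num_real // exprn_ile1 // cos_max.
have mk : measurable_fun setT (fun y : 'rV[R]_d => cos_kernel N (x - y)).
  have -> : (fun y => cos_kernel N (x - y)) = (fun y : 'rV[R]_d =>
      \sum_(m : {ffun 'I_d -> 'I_(N.*2).+1})
       cos_kernel_coef m * cos (2 * pi * dotZ (freq m) (x - y))).
    by apply/funext => y; rewrite cos_kernelE.
  apply: measurable_sum => m; apply: measurable_funM => //.
  exact: measurable_cos_dotZ.
have ki (g : 'rV[R]_d -> R) : (mu d).-integrable (cube d) (EFin \o g) ->
    (mu d).-integrable (cube d) (EFin \o (fun y => g y * cos_kernel N (x - y))).
  by move=> gi; exact: (integrable_mul_bounded gi mk).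
have gi : (mu d).-integrable (cube d) (EFin \o (fun y => f x - f y)).
  exact: (integrableB mD (integrable_cst_cube d (f x)) fi).
have ni (g : 'rV[R]_d -> R) : (mu d).-integrable (cube d) (EFin \o g) ->
    (mu d).-integrable (cube d) (EFin \o (fun y => `|g y|)).
  by move=> ?; exact: integrable_norm.
have -> : cos_kernel_mass d N * f x - mollify N f x =
   Rintegral (mu d) (cube d) (fun y => (f x - f y) * cos_kernel N (x - y)).
  rewrite -(Rintegral_cos_kernel N x) mulrC -RintegralZl //; last first.
    have -> : (fun y => cos_kernel N (x - y)) = (fun y => 1 * cos_kernel N (x - y)).
      by apply/funext => y; rewrite mul1r.
    exact: (ki (fun=> 1) (integrable_cst_cube d 1)).
  rewrite /mollify -RintegralB //.
  - by apply: eq_Rintegral => y _; rewrite mulrBl.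
  - exact: (ki (fun=> f x) (integrable_cst_cube d (f x))).
  - exact: ki.
apply: le_trans (le_normr_Rintegral mD (ki _ gi)) _.
(* [G] adds the near bound and the far bound, so a single pointwise majorant replaces a splitting of
   the cube. *)
pose G y := eta * cos_kernel N (x - y) + (`|f x| + `|f y|) * B.
have i1 : (mu d).-integrable (cube d) (EFin \o (fun y => eta * cos_kernel N (x - y))).
  exact: (ki (fun=> eta) (integrable_cst_cube d eta)).
have i2 : (mu d).-integrable (cube d) (EFin \o (fun y => `|f x| + `|f y|)).
  exact: (integrableD mD (integrable_cst_cube d `|f x|) (ni _ fi)).
have i3 : (mu d).-integrable (cube d) (EFin \o (fun y => (`|f x| + `|f y|) * B)).
  exact: (integrable_mul_bounded (h := fun=> B) (M := `|B|) i2).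
apply: (@le_trans _ _ (Rintegral (mu d) (cube d) G)).
  apply: le_Rintegral => //.
  - exact: (ni _ (ki _ gi)).
  - exact: (integrableD mD i1 i3).
  move=> y Dy; rewrite normrM (ger0_norm (cos_kernel_ge0 _ _)) /G.
  have k0 := cos_kernel_ge0 N (x - y).
  have B0 : 0 <= B by apply: mulr_ge0; [do 2 apply: exprn_ge0|apply: exprn_ge0; exact: sqr_ge0].
  have [near|] := pselect (forall j, `|x ord0 j - y ord0 j| < e).
    rewrite -[leLHS]addr0; apply: lerD; first by rewrite ler_wpM2r // fnear.
    by apply: mulr_ge0 => //; exact: addr_ge0.
  move=> /existsNP[j /negP]; rewrite -leNgt => far.
  rewrite -[leLHS]add0r; apply: lerD; first exact: mulr_ge0.
  apply: ler_pM => //; first exact: ler_normB.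
  apply: (@cos_kernel_le_far _ _ _ _ j) => //.
  rewrite !mxE far /= ler_norml.
  have := xint j; have := Dy j; move/andP: e01 => [? ?].
  by move=> /andP[? ?] /andP[? ?]; apply/andP; split; lra.
rewrite RintegralD // RintegralZr // RintegralD //; last 2 first.
- exact: (integrable_cst_cube d `|f x|).
- exact: ni.
rewrite RintegralZl //; last first.
  have -> : (fun y => cos_kernel N (x - y)) = (fun y => 1 * cos_kernel N (x - y)).
    by apply/funext => y; rewrite mul1r.
  exact: (ki (fun=> 1) (integrable_cst_cube d 1)).
by rewrite Rintegral_cos_kernel Rintegral_cst // [X in fine X](lebesgue_rV_unit_cube d) mulr1.
Qed.

Lemma cvg_mollify d (f : 'rV[R]_d -> R) x e : {within cube d, continuous f} ->
  (mu d).-integrable (cube d) (EFin \o f) -> 0 < e -> interior_point e x ->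
  (fun N => mollify N f x / cos_kernel_mass d N) @ \oo --> f x.
Proof.
move=> cf fi e0 xint; apply/cvgrPdist_le => eta eta0.
have Dx : cube d x by move=> j; have := xint j; case/andP => *; apply/andP; split; lra.
have [e1 e10 fnear] := within_cube_near cf Dx (divr_gt0 eta0 (ltr0n R 2)).
(* Below the continuity radius, below the margin of [x], and at most 1/2 for the cosine bounds. *)
pose e2 := Num.min e1 (Num.min e (2^-1)).
have e20 : 0 < e2 <= 2^-1 by rewrite !lt_min e10 e0 invr_gt0 ltr0n /= !ge_min lexx !orbT.
have e2e : e2 <= e by rewrite !ge_min lexx !orbT.
have xint2 : interior_point e2 x.
  by move=> j; have := xint j; case/andP => *; apply/andP; split; lra.
have fnear2 y : cube d y -> (forall j, `|x ord0 j - y ord0 j| < e2) -> `|f x - f y| <= eta / 2.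
  by move=> Dy h; apply: fnear => // j; apply: lt_le_trans (h j) _; rewrite ge_min lexx.
have [C C0 hC] := exp_beats_poly d (cos_sqr_lt1 e20).
set K := `|f x| + Rintegral (mu d) (cube d) (fun y => `|f y|).
have K0 : 0 <= K by rewrite addr_ge0 // Rintegral_ge0.
(* Chosen so that [K C / N <= eta / 2] from [N0] on. *)
pose N0 := (Num.trunc (2 * (K * C) / eta)).+1.
exists N0 => // N /= N0N.
have N00 : (0 < N)%N by apply: leq_trans N0N.
have NR0 : 0 < N%:R :> R by rewrite ltr0n.
have z0 := @cos_kernel_mass_gt0 R d N; set z := cos_kernel_mass d N in z0 *.
have eta2 : 0 <= eta / 2 by lra.
have := mollify_dist N eta2 fi xint2 e20 fnear2; rewrite -/z -/K.
set q := cos (pi * e2) ^+ 2 in hC *.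
have q0 : 0 <= q by rewrite sqr_ge0.
move=> H.
(* The mass is within the factor [(2N + 1) ^ d] of the maximum [4 ^ (N d)], and this polynomial loss
   is beaten by [q ^ N]. *)
have KC : K * ((4 ^+ N) ^+ d * q ^+ N) <= K * (C / N%:R) * z.
  rewrite -mulrA ler_wpM2l //.
  apply: le_trans (_ : (N.*2.+1)%:R ^+ d * z * q ^+ N <= _).
    by rewrite ler_wpM2r //; [exact: exprn_ge0|exact: cos_kernel_mass_ge].
  by rewrite mulrAC ler_wpM2r ?(ltW z0) // hC.
have KN : K * (C / N%:R) <= eta / 2.
  have : 2 * (K * C) / eta < N%:R.
    have /andP[_ h] : (Num.trunc (2 * (K * C) / eta))%:R <= 2 * (K * C) / eta < N0%:R.
      by apply: truncn_itv; rewrite divr_ge0 ?mulr_ge0 // ltW.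
    by apply: lt_le_trans h _; rewrite ler_nat.
  by rewrite ltr_pdivrMr // => h; rewrite mulrA ler_pdivrMr //; lra.
have -> : f x - mollify N f x / z = (z * f x - mollify N f x) / z.
  by rewrite mulrBl mulrAC divff ?mul1r // gt_eqF.
rewrite normrM normfV (gtr0_norm z0) ler_pdivrMr //.
have Kz : K * (C / N%:R) * z <= eta / 2 * z by rewrite ler_wpM2r // ltW.
by apply: le_trans H _; lra.
Qed.

End approximation.

(** * Error of a quadrature rule *)

Section quadrature.
Context {R : realType}.

Local Notation mu d := (@lebesgue_rV R d).
Local Notation cube d := (@unit_cube R d).

Lemma fourier_coef0 d (f : 'rV[R]_d -> R) : Re (fourier_coef f 0) = Iint f.
Proof.
rewrite /= /Iint; apply: eq_Rintegral => y _.
by rewrite dotZ0 mulr0 oppr0 cos0 sin0 mulr1 mul0r subr0.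
Qed.

Lemma sum_freq_le_Fnorm d N (r : 'rV[int]_d -> R) (f : 'rV[R]_d -> R) :
  (forall k, 0 <= r k) ->
  ((\sum_(m : {ffun 'I_d -> 'I_(N.*2).+1})
     normc (fourier_coef f (freq m)) * r (freq m))%:E <= Fnorm r f)%E.
Proof.
move=> r0; apply: esum_ge.
pose s := [seq freq m | m <- index_enum {ffun 'I_d -> 'I_(N.*2).+1}].
have us : uniq s by rewrite map_inj_uniq ?index_enum_uniq //; exact: freq_inj.
exists [set` s]; first by split=> //; exact: finite_seq.
by rewrite -fsbig_seq // big_map -sumEFin.
Qed.

Variables (d : nat) (T : finType) (c : T -> R) (x : T -> 'rV[R]_d).

(** The rule applied to the exponential of frequency [k]; for [k != 0] its modulus is the
    integration error there. *)
Definition exp_sum (k : 'rV[int]_d) : R[i] :=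
  \sum_t (c t)%:C%C * expi (2 * pi * dotZ k (x t)).

Lemma sum_mollify N (f : 'rV[R]_d -> R) :
  (mu d).-integrable (cube d) (EFin \o f) ->
  \sum_t c t * mollify N f (x t) =
  \sum_(m : {ffun 'I_d -> 'I_(N.*2).+1})
    cos_kernel_coef m * Re (exp_sum (freq m) * fourier_coef f (freq m)).
Proof.
move=> fi; under eq_bigr do rewrite mollifyE // mulr_sumr.
rewrite exchange_big; apply: eq_bigr => m _.
rewrite /exp_sum mulr_suml Re_sum mulr_sumr; apply: eq_bigr => t _.
by rewrite -[(_ * expi _) * _]mulrA ReZ mulrCA.
Qed.

(** The bound is proved with the normalised mollifications in place of the node values, uniformly in
    [N], and then passes to the limit because all nodes are interior. *)
Lemma quadrature_error (r : 'rV[int]_d -> R) (delta e : R) (f : 'rV[R]_d -> R) :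
  0 < e -> (forall t, interior_point e (x t)) ->
  \sum_t c t = 1 -> 0 <= delta -> (forall k, 0 <= r k) ->
  (forall k, k != 0 -> normc (exp_sum k) <= delta * r k) ->
  Fspace r f -> (Fnorm r f <= 1)%E ->
  `|Iint f - \sum_t c t * f (x t)| <= delta.
Proof.
move=> e0 xint c1 delta0 r0 hk [cf fi _] f1.
have cvgQ : (fun N => \sum_t c t * (mollify N f (x t) / cos_kernel_mass d N)) @ \oo -->
    \sum_t c t * f (x t).
  apply: cvg_big => [|t _]; first exact: add_continuous.
  by apply: cvgMr; exact: (cvg_mollify cf fi e0).
have cvgN : (fun N => `|Iint f - \sum_t c t * (mollify N f (x t) / cos_kernel_mass d N)|)
    @ \oo --> `|Iint f - \sum_t c t * f (x t)|.
  by apply: cvg_norm; apply: cvgB => //; exact: cvg_cst.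
apply: (cvgr_to_le cvgN); near=> N.
have z0 := @cos_kernel_mass_gt0 R d N; set z := cos_kernel_mass d N in z0 *.
have -> : \sum_t c t * (mollify N f (x t) / z) = (\sum_t c t * mollify N f (x t)) / z.
  by rewrite mulr_suml; apply: eq_bigr => t _; rewrite mulrA.
(* The weights sum to 1, so frequency zero contributes exactly [z * Iint f] and cancels; the other
   frequencies form the error. *)
rewrite sum_mollify // (bigD1 (central_index d N)) //= cos_kernel_coef_central.
rewrite freq_central -/z.
have -> : exp_sum 0 = 1.
  rewrite /exp_sum; under eq_bigr do rewrite dotZ0 mulr0 expi0 mulr1.
  by rewrite -rmorph_sum /= c1.
rewrite -[X in z * X]/(Re (1 * fourier_coef f 0)) mul1r fourier_coef0.
rewrite mulrDl mulrAC divff ?gt_eqF // mul1r opprD addrA subrr add0r normrN.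
rewrite normrM normfV (gtr0_norm z0) ler_pdivrMr //.
apply: le_trans (ler_norm_sum _ _ _) _.
have S1 : \sum_(m : {ffun 'I_d -> 'I_(N.*2).+1})
     normc (fourier_coef f (freq m)) * r (freq m) <= 1.
  by rewrite -lee_fin; apply: le_trans f1; exact: sum_freq_le_Fnorm.
have : delta * z * (\sum_(m : {ffun 'I_d -> 'I_(N.*2).+1})
     normc (fourier_coef f (freq m)) * r (freq m)) <= delta * z.
  by rewrite ler_piMr // mulr_ge0 // ltW.
apply: le_trans.
rewrite mulr_sumr [leRHS](bigD1 (central_index d N)) // -[leLHS]add0r.
apply: lerD.
  by rewrite !mulr_ge0 ?(ltW z0) ?normc_ge0.
apply: ler_sum => m mN.
have /andP[b0 bz] := @cos_kernel_coef_le R d N m.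
rewrite normrM (ger0_norm b0) -/z in bz *.
apply: le_trans (ler_wpM2l b0 (normr_Re_le _)) _.
rewrite ComplexField.Normc.normcM.
have h := hk (freq m); rewrite freq_eq0 in h.
apply: le_trans (_ : z * (delta * r (freq m) * normc (fourier_coef f (freq m))) <= _).
  apply: ler_pM => //; first by rewrite mulr_ge0 ?normc_ge0.
  by rewrite ler_wpM2r ?normc_ge0 // h.
by rewrite le_eqVlt; apply/orP; left; apply/eqP; ring.
Unshelve. all: by end_near.
Qed.

Lemma reaches_finType (r : 'rV[int]_d -> R) (eps : R) :
  (forall t, cube d (x t)) ->
  (forall f, Fspace r f -> (Fnorm r f <= 1)%E ->
     `|Iint f - \sum_t c t * f (x t)| <= eps) ->
  reaches eps r #|T|.
Proof.
move=> xD hf; exists (c \o enum_val), (x \o enum_val); split; first by move=> h; exact: xD.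
apply: ge_ereal_sup => _ [f [fF f1] <-]; rewrite lee_fin.
rewrite (_ : linear_algorithm _ _ f = \sum_t c t * f (x t)) ?hf //.
rewrite [RHS](reindex (fun i : 'I_#|T| => enum_val i)) //.
by apply: onW_bij; exact: enum_val_bij.
Qed.

End quadrature.

Lemma nwor_le (R : realType) d (r : 'rV[int]_d -> R) eps n :
  reaches eps r n -> (nwor eps r <= n%:R%:E)%E.
Proof.
move=> rn; rewrite /nwor; case: pselect => [h|[]]; last by exists n; apply/asboolP.
by case: ex_minnP => m _ hm; rewrite lee_fin ler_nat hm //; apply/asboolP.
Qed.

(** * Korobov's p-sets *)

Section pset.
Context {R : realType}.

(** The residue over [p] is the fractional part of [h g ^ j / p]; the shift by [1 / (2p)] moves the
    node off the faces of the cube. *)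
Definition pset_point d p (g h : nat) : 'rV[R]_d :=
  \row_j (((h * g ^ j) %% p)%N%:R / p%:R + (2 * p%:R)^-1).

Definition pset_phase d (k : 'rV[int]_d) (g : nat) : int :=
  \sum_(j < d) k ord0 j * (g ^ j)%N%:Z.

(** Stated with a common bound [M] so that one margin serves all primes of the average. *)
Lemma pset_point_interior d p M g h : (0 < p <= M)%N ->
  interior_point (2 * M%:R)^-1 (pset_point d p g h).
Proof.
case/andP=> p0 pM j; rewrite mxE; set a := (_ %% p)%N.
have p0R : 0 < p%:R :> R by rewrite ltr0n.
have e : (2 * M%:R)^-1 <= (2 * p%:R)^-1 :> R.
  rewrite lef_pV2 ?posrE ?mulr_gt0 ?ltr0n //; last by apply: leq_trans pM.
  by rewrite ler_pM2l // ler_nat.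
have a0 : 0 <= a%:R / p%:R :> R by rewrite divr_ge0.
have ap : a%:R / p%:R + p%:R^-1 <= 1 :> R.
  have ap : (a < p)%N by rewrite ltn_mod.
  have -> : a%:R / p%:R + p%:R^-1 = a.+1%:R / p%:R :> R by rewrite -natr1 mulrDl mul1r.
  by rewrite ler_pdivrMr // mul1r ler_nat.
have e2 : p%:R^-1 = (2 * p%:R)^-1 + (2 * p%:R)^-1 :> R by field; rewrite gt_eqF.
by apply/andP; split; lra.
Qed.

Lemma interior_point_cube d (e : R) (x : 'rV[R]_d) : 0 < e -> interior_point e x ->
  unit_cube d x.
Proof.
by move=> e0 xe j; have := xe j => /andP[? ?]; apply/andP; split; lra.
Qed.

(** The shift only yields a unimodular factor independent of [g] and [h]. *)
Lemma expi_pset_point d (k : 'rV[int]_d) p g h : (0 < p)%N ->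
  expi (2 * pi * dotZ k (pset_point d p g h)) =
  expi (2 * pi * ((\sum_j k ord0 j)%:~R / (2 * p%:R))) *
  expi (2 * pi * (h%:R * (pset_phase k g)%:~R / p%:R)) :> R[i].
Proof.
move=> p0; have pN0 : p%:R != 0 :> R by rewrite pnatr_eq0 -lt0n.
rewrite -expiD -mulrDr.
(* The integer discarded by the reductions modulo [p], invisible to the exponential. *)
pose q : int := \sum_(j < d) k ord0 j * ((h * g ^ j) %/ p)%N%:Z.
have -> : (\sum_j k ord0 j)%:~R / (2 * p%:R) + h%:R * (pset_phase k g)%:~R / p%:R =
    dotZ k (pset_point d p g h) + q%:~R :> R.
  rewrite /pset_phase /q /dotZ !rmorph_sum /= mulr_suml mulr_sumr mulr_suml -!big_split /=.
  apply: eq_bigr => j _; rewrite mxE !rmorphM /= -!pmulrn.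
  have := congr1 (fun n => n%:R : R) (divn_eq (h * g ^ j) p).
  rewrite natrD !natrM; set a := (_ %/ _)%:R; set b := (_ %% _)%:R.
  set u := h%:R; set v := (g ^ j)%:R => uv.
  have -> : u * (((k ord0 j)%:~R) * v) = (k ord0 j)%:~R * (u * v) by ring.
  by rewrite uv; field.
by rewrite [2 * pi * (_ + q%:~R)]mulrDr expiD expi_2pi_int mulr1.
Qed.

Lemma normc_sum_pset d (k : 'rV[int]_d) p : (0 < p)%N ->
  normc (\sum_(u : 'I_p * 'I_p) expi (2 * pi * dotZ k (pset_point d p u.1 u.2))) <=
  (p * #|[pred g : 'I_p | (p %| pset_phase k g)%Z]|)%N%:R :> R.
Proof.
move=> p0; under eq_bigr do rewrite expi_pset_point //.
rewrite -mulr_sumr ComplexField.Normc.normcM normc_expi mul1r.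
rewrite -(pair_bigA _ (fun g h : 'I_p =>
  expi (2 * pi * (h%:R * (pset_phase k g)%:~R / p%:R)))) /=.
under eq_bigr do rewrite sum_expi_char //.
apply: le_trans (le_normc_sum _ _ _) _.
rewrite (eq_bigr (fun g : 'I_p => if (p %| pset_phase k g)%Z then p%:R else 0)); last first.
  move=> g _; case: ifP => _; last by rewrite ComplexField.Normc.normc0.
  have -> : (p%:R : R[i]) = (p%:R)%:C%C by rewrite rmorph_nat.
  by rewrite normc_real normr_nat.
by rewrite -big_mkcond sumr_const natrM mulr_natr.
Qed.

(** Over ['F_p] these [g] are roots of the polynomial with coefficients [k_i], which is nonzero at
    index [j] and has degree below [d]; distinct [g < p] stay distinct in the field. *)
Lemma card_pset_roots d (k : 'rV[int]_d) p (j : 'I_d) : prime p ->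
  ~~ (p %| k ord0 j)%Z -> (#|[pred g : 'I_p | (p %| pset_phase k g)%Z]| <= d)%N.
Proof.
move=> pp pk.
have pchar : p \in [pchar 'F_p] by exact: pchar_Fp.
have dvdF (a : int) : ((a%:~R : 'F_p) == 0) = (p %| a)%Z.
  have nF n : ((n%:R : 'F_p) == 0) = (p %| n)%N by rewrite -(dvdn_pcharf pchar).
  case: a => n; first by rewrite -pmulrn nF.
  by rewrite NegzE mulrNz oppr_eq0 -pmulrn nF rpredN.
pose P : {poly 'F_p} := \poly_(i < d) (if insub i is Some i' then (k ord0 i')%:~R else 0).
have P0 : P != 0.
  apply/eqP => /(congr1 (fun q : {poly 'F_p} => q`_j)).
  by rewrite coef_poly ltn_ord coef0 valK => /eqP; rewrite dvdF (negbTE pk).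
have Pg (g : nat) : P.[g%:R] = (pset_phase k g)%:~R.
  rewrite horner_poly rmorph_sum /=; apply: eq_bigr => i _.
  by rewrite valK rmorphM /= -pmulrn natrX.
set S := [pred g | _].
have := @max_poly_roots _ P [seq (nat_of_ord g)%:R | g <- enum S] P0.
rewrite size_map -cardE => H; apply: ltnW; apply: (leq_trans _ (size_poly _ _)); apply: H.
- by apply/allP => _ /mapP[g gS ->]; rewrite /root Pg dvdF; rewrite mem_enum inE in gS.
- rewrite map_inj_in_uniq ?enum_uniq // => g g' _ _ gg.
  apply/val_inj; rewrite /= -(modn_small (ltn_ord g)) -(modn_small (ltn_ord g')).
  by have := congr1 (fun x : 'F_p => val x) gg; rewrite /= !val_Fp_nat.
Qed.

Lemma normc_sum_pset_le d (k : 'rV[int]_d) p (j : 'I_d) : prime p ->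
  normc (\sum_(u : 'I_p * 'I_p) expi (2 * pi * dotZ k (pset_point d p u.1 u.2))) /
    p%:R ^+ 2 <= (p %| k ord0 j)%Z%:R + d%:R / p%:R :> R.
Proof.
move=> pp; have p0 := prime_gt0 pp.
have p0R : 0 < p%:R :> R by rewrite ltr0n.
have := normc_sum_pset k p0; set S := normc _; set r := #|_| => h.
rewrite ler_pdivrMr ?exprn_gt0 //; apply: le_trans h _.
have [pk|pk] := boolP (p %| k ord0 j)%Z.
  have rp : (r <= p)%N by rewrite -[X in (_ <= X)%N]card_ord max_card.
  apply: le_trans (_ : p%:R ^+ 2 <= _).
    by rewrite -natrX ler_nat leq_mul2l rp orbT.
  by rewrite ler_peMl ?exprn_ge0 // lerDl divr_ge0.
have rd : (r <= d)%N by exact: card_pset_roots pk.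
have -> : (false%:R + d%:R / p%:R) * p%:R ^+ 2 = (p * d)%N%:R :> R.
  by rewrite [_ + _]add0r natrM; field; rewrite gt_eqF.
by rewrite ler_nat leq_mul2l rd orbT.
Qed.

(** The primes counted are distinct and exceed [m], and their product divides [|a|]; take
    logarithms. *)
Lemma count_prime_divisors m M (a : int) : a != 0 -> (0 < m)%N ->
  (count (fun p : nat => (p %| a)%Z) (primes_between m M))%:R * ln (m%:R : R) <=
  ln (`|a|%:~R).
Proof.
move=> a0 m0; set P := primes_between m M; set c := count _ _.
have aN : (0 < `|a|)%N by rewrite absz_gt0.
have -> : (`|a|%:~R : R) = `|a|%N%:R by rewrite -abszE -pmulrn.
rewrite -ln_natX //; apply: ln_nat_le; rewrite expn_gt0 m0 /=.
pose Q := seq.filter (fun p : nat => (p %| a)%Z) P.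
have mQ p : p \in Q -> [&& prime p, (m < p)%N & (p %| `|a|)%N].
  by rewrite mem_filter mem_primes_between => /andP[? /and3P[-> -> _]].
apply: leq_trans (_ : (\prod_(p <- Q) p <= _)%N); last first.
  apply: dvdn_leq => //; apply: prod_primes_dvd.
  - by rewrite filter_uniq ?uniq_primes_between.
  - by apply/allP => p /mQ /and3P[].
  - by apply/allP => p /mQ /and3P[].
rewrite /c -size_filter -/Q -[X in (m ^ X)%N]count_predT -iter_muln_1 -big_const_seq.
rewrite big_seq [leqRHS]big_seq; apply: leq_prod => p /mQ /and3P[_ /ltnW].
by [].
Qed.

End pset.

(** * Averaging the p-sets over the primes in [(m, 4m]] *)

Section algorithm.
Context {R : realType}.
Variables (d m : nat).
Local Notation P := (primes_between m (4 * m)).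
Local Notation s := (size P).
Let pr (i : 'I_s) : nat := nth 0%N P i.

(** A dependent sum, because the range of the parameters [(g, h)] varies with the prime. *)
Definition pset_index : finType := {i : 'I_s & ('I_(pr i) * 'I_(pr i))%type}.

Definition pset_weight (t : pset_index) : R := (s%:R * (pr (tag t))%:R ^+ 2)^-1.

Definition pset_node (t : pset_index) : 'rV[R]_d :=
  pset_point d (pr (tag t)) (tagged t).1 (tagged t).2.

Let prP i : [&& prime (pr i), (m < pr i)%N & (pr i <= 4 * m)%N].
Proof. by rewrite -mem_primes_between mem_nth. Qed.

Lemma card_pset_index : (#|{: pset_index}| <= s * (4 * m) ^ 2)%N.
Proof.
rewrite card_tagged sumnE big_map big_enum /=.
apply: leq_trans (_ : (\sum_(i < s) (4 * m) ^ 2 <= _)%N).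
  apply: leq_sum => i _; rewrite card_prod card_ord mulnn leq_sqr.
  by case/and3P: (prP i).
by rewrite sum_nat_const card_ord.
Qed.

Lemma pset_node_interior (t : pset_index) :
  interior_point (2 * (4 * m)%N%:R)^-1 (pset_node t).
Proof.
by apply: pset_point_interior; case/and3P: (prP (tag t)) => /prime_gt0 -> _ ->.
Qed.

Lemma sum_pset_weight : (0 < s)%N -> \sum_t pset_weight t = 1.
Proof.
move=> s0; rewrite /pset_weight.
rewrite -(@sig_big_dep _ _ _ _ (fun i : 'I_s => ('I_(pr i) * 'I_(pr i))%type : finType)
  xpredT (fun _ => xpredT)
  (fun i (_ : ('I_(pr i) * 'I_(pr i))%type) => (s%:R * (pr i)%:R ^+ 2)^-1 : R)) /=.
have wE i : (s%:R * (pr i)%:R ^+ 2)^-1 * (pr i * pr i)%N%:R = s%:R^-1 :> R.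
  have pi0 : (pr i)%:R != 0 :> R.
    by rewrite pnatr_eq0 -lt0n; case/and3P: (prP i) => /prime_gt0.
  have s0R : s%:R != 0 :> R by rewrite pnatr_eq0 -lt0n.
  by rewrite natrM; field; rewrite ?pi0 ?s0R.
under eq_bigr => i _.
  rewrite sumr_const card_prod card_ord -[_ *+ (pr i * pr i)]mulr_natr wE.
  over.
by rewrite sumr_const card_ord -[_^-1 *+ s]mulr_natr mulVf // pnatr_eq0 -lt0n.
Qed.

(** Average of [normc_sum_pset_le] with the same [j] for all primes: those dividing [k_j] cost 1
    each, and [d / p <= d / m]. *)
Lemma normc_exp_sum_pset (k : 'rV[int]_d) (j : 'I_d) : (0 < s)%N -> (0 < m)%N ->
  normc (exp_sum pset_weight pset_node k) <=
  (count (fun p : nat => (p %| k ord0 j)%Z) P)%:R / s%:R + d%:R / m%:R.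
Proof.
move=> s0 m0; rewrite /exp_sum /pset_weight /pset_node.
rewrite -(@sig_big_dep _ _ _ _ (fun i : 'I_s => ('I_(pr i) * 'I_(pr i))%type : finType)
  xpredT (fun _ => xpredT)
  (fun i (u : ('I_(pr i) * 'I_(pr i))%type) => ((s%:R * (pr i)%:R ^+ 2)^-1 : R)%:C%C *
    expi (2 * pi * dotZ k (pset_point d (pr i) u.1 u.2)))) /=.
apply: le_trans (le_normc_sum _ _ _) _.
apply: (@le_trans _ _ (\sum_(i < s) s%:R^-1 * ((pr i %| k ord0 j)%Z%:R + d%:R / m%:R))).
  apply: ler_sum => i _; case/and3P: (prP i) => pp mp _; have p0 := prime_gt0 pp.
  rewrite -mulr_sumr ComplexField.Normc.normcM normc_real ger0_norm; last first.
    by rewrite invr_ge0 mulr_ge0 ?exprn_ge0.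
  rewrite invfM -mulrA ler_wpM2l ?invr_ge0 // mulrC.
  apply: le_trans (normc_sum_pset_le k j pp) _.
  rewrite lerD2l ler_wpM2l // lef_pV2 ?posrE ?ltr0n // ler_nat.
  exact: ltnW.
rewrite -mulr_sumr big_split /= sumr_const card_ord -[(d%:R / m%:R) *+ s]mulr_natr mulrDr.
have s0R : s%:R != 0 :> R by rewrite pnatr_eq0 -lt0n.
rewrite [X in _ + X]mulrC mulfK // lerD2r mulrC.
rewrite ler_wpM2r ?invr_ge0 // -natr_sum ler_nat.
rewrite -sum1_count (big_nth 0%N) big_mkord [leqRHS]big_mkcond.
by apply: leq_sum => i _; case: ifP.
Qed.

End algorithm.

(** * The error in terms of [r3] and the choice of [m] *)

Lemma r3_factor_le (R : realType) d (k : 'rV[int]_d) (j : 'I_d) :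
  Num.max 1 (ln (`|k ord0 j|%:~R)) <= r3 d k :> R.
Proof.
rewrite /r3 (bigD1 j) //= ler_peMr //; first by rewrite le_max ler01.
elim/big_ind : _ => // [x y x1 y1|i _]; last by rewrite le_max lexx.
by rewrite -[leLHS]mulr1 ler_pM.
Qed.

(** For a nonzero [k_j], at most [ln |k_j| / ln m] of at least [m / (4 ln m)] primes divide it, a
    proportion of at most [4 r3 / m]. Adding [d / m] gives the constant 5, as [d] and [r3] are at
    least 1. *)
Lemma exp_sum_pset_le_r3 (R : realType) d m (k : 'rV[int]_d) :
  20 ^+ 4 <= m%:R :> R -> (0 < d)%N -> k != 0 ->
  ComplexField.Normc.normc (exp_sum (@pset_weight R m) (@pset_node R d m) k) <=
  5 * d%:R / m%:R * r3 d k :> R.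
Proof.
move=> mbig d0 k0.
have [j kj] : exists j, k ord0 j != 0.
  apply/existsP; apply: contraNT k0 => /existsPn h.
  by apply/eqP/rowP => j; rewrite mxE; apply/eqP; rewrite -[_ == _]negbK h.
have mR : 0 < m%:R :> R by apply: lt_le_trans mbig; rewrite exprn_gt0.
have m0 : (0 < m)%N by rewrite -(ltr0n R).
have hs := @size_primes_between_ge R m mbig.
have := @normc_exp_sum_pset R d m k j.
have := @count_prime_divisors R m (4 * m) (k ord0 j) kj m0.
set c := (count _ _)%:R; set s := size _ in hs *; set L := ln _.
have lm0 : 0 < ln (m%:R : R).
  by rewrite ln_gt0 //; apply: lt_le_trans mbig; rewrite exprn_egt1 // ltr1n.
have s0 : (0 < s)%N.
  rewrite lt0n; apply/eqP => s0; move: hs; rewrite s0 mul0r leNgt => /negP; apply.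
  by rewrite divr_gt0.
have sR : 0 < s%:R :> R by rewrite ltr0n.
move=> hc /(_ s0 m0) h; apply: le_trans h _.
have := @r3_factor_le R d k j; rewrite ge_max => /andP[r1 rL].
have dR : 1 <= d%:R :> R by rewrite ler1n.
rewrite -/L in rL hc.
have cL : c / s%:R <= 4 * r3 d k / m%:R.
  rewrite ler_pdivrMr // mulrAC ler_pdivlMr //.
  have cm : c * m%:R <= 4 * (c * (s%:R * ln m%:R)).
    have c0 : 0 <= c by [].
    by have := ler_wpM2l c0 hs; lra.
  apply: le_trans cm _.
  rewrite -mulrA ler_pM2l //= mulrCA [leRHS]mulrC ler_pM2l //.
  exact: le_trans rL.
have dr : d%:R / m%:R + 4 * r3 d k / m%:R <= 5 * d%:R / m%:R * r3 d k :> R.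
  rewrite -mulrDl [leRHS]mulrAC ler_pM2r ?invr_gt0 //.
  nra.
by rewrite addrC; apply: le_trans dr; rewrite lerD2l.
Qed.

Theorem theorem3 (R : realType) :
  exists C : R, 0 < C /\
    forall (d : nat) (eps : R), (0 < d)%N -> 0 < eps < 1 ->
      (nwor eps (r3 d) <=
         (C * d%:R ^+ 3 * eps ^- 3 / ln (d%:R * eps^-1))%:E)%E.
Proof.
(* [K] is the threshold of the Chebyshev lower bound, kept abstract so that its numeral does not
   enter the later arithmetic. *)
have [K KE] : exists K : R, K = 20 ^+ 4 by exists (20 ^+ 4).
have K0 : 0 < K by rewrite KE exprn_gt0.
have K5 : 5 <= K by rewrite KE; lra.
(* [1024 K ^ 3 = 128 (2K) ^ 3]: here [128 = 16 * 8] comes from [(4m) ^ 2] nodes per prime and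
   [s ln D <= 8m], and [2K] from [m <= 2 K D]. *)
exists (1024 * K ^+ 3); split; first by apply: mulr_gt0; [rewrite ltr0n|exact: exprn_gt0].
move=> d eps d0 /andP[eps0 eps1]; set D := d%:R * eps^-1.
have dR : 1 <= d%:R :> R by rewrite ler1n.
have D1 : 1 < D by rewrite /D ltr_pdivlMr // mul1r; apply: lt_le_trans dR.
(* The least integer above [K D], so that [5 d / m <= 5 eps / K <= eps]. *)
pose m := (Num.trunc (K * D)).+1.
have /andP[m1 m2] : (Num.trunc (K * D))%:R <= K * D < m%:R.
  by apply: truncn_itv; rewrite mulr_ge0 ?ltW // (lt_trans _ D1).
have mE : m%:R = (Num.trunc (K * D))%:R + 1 :> R by rewrite -natr1.
have KD : K <= K * D by rewrite ler_peMr ?ltW.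
have mle : m%:R <= 2 * K * D by lra.
have mbig : 20 ^+ 4 <= m%:R :> R by rewrite -KE; lra.
have mR : 0 < m%:R :> R by lra.
have m0 : (0 < m)%N by [].
have hs := @size_primes_between_ge R m mbig.
have hs2 := @size_primes_between_le R m (4 * m) m0.
have s0 : (0 < size (primes_between m (4 * m)))%N.
  rewrite lt0n; apply/eqP => s0; move: hs; rewrite s0 mul0r leNgt => /negP; apply.
  by rewrite divr_gt0.
have rT : reaches eps (r3 d : _ -> R) #|{: pset_index m}|.
  have int t := @pset_node_interior R d m t.
  have e0 : 0 < (2 * (4 * m)%N%:R)^-1 :> R by rewrite invr_gt0 mulr_gt0 ?ltr0n.
  apply: (@reaches_finType _ _ _ (@pset_weight R m) (@pset_node R d m)).
    by move=> t; exact: (interior_point_cube e0).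
  move=> f fF f1.
  apply: (@le_trans _ _ (5 * d%:R / m%:R)); last first.
    rewrite ler_pdivrMr //.
    have : eps * (K * D) <= eps * m%:R by rewrite ler_pM2l // ltW.
    have -> : eps * (K * D) = K * d%:R by rewrite /D; field; rewrite gt_eqF.
    by apply: le_trans; rewrite ler_pM2r // (lt_le_trans _ dR).
  apply: (@quadrature_error _ _ _ _ _ (r3 d) _ _ f e0 int) => //.
  - exact: sum_pset_weight.
  - by move=> k; apply: le_trans (r3_ge1 k).
  - by move=> k k0; exact: exp_sum_pset_le_r3.
apply: le_trans (nwor_le rT) _; rewrite lee_fin.
have lnD : 0 < ln D by rewrite ln_gt0.
have -> : 1024 * K ^+ 3 * d%:R ^+ 3 * eps ^- 3 = 128 * (2 * K * D) ^+ 3.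
  by rewrite /D; field; rewrite gt_eqF.
rewrite ler_pdivlMr //.
have := card_pset_index m; rewrite -(ler_nat R) natrM natrX natrM => hT.
apply: le_trans (ler_wpM2r (ltW lnD) hT) _.
have lDm : ln D <= ln m%:R.
  by rewrite ler_ln ?posrE ?(lt_trans _ D1) //; nra.
set s := (size _)%:R in hs hs2 *.
(* The upper Chebyshev bound on the number of primes produces the logarithm in the denominator. *)
have sl : s * ln D <= 8 * m%:R.
  apply: le_trans (ler_wpM2l _ lDm) _; first by [].
  by apply: le_trans hs2 _; rewrite natrM; lra.
have m3 : 128 * m%:R ^+ 3 <= 128 * (2 * K * D) ^+ 3.
  by rewrite ler_pM2l // lerXn2r ?nnegrE ?ltW //; lra.
apply: le_trans m3.
have -> : s * (4 * m%:R) ^+ 2 * ln D = 16 * m%:R ^+ 2 * (s * ln D) by ring.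
have -> : 128 * m%:R ^+ 3 = 16 * m%:R ^+ 2 * (8 * m%:R) :> R by ring.
by rewrite ler_wpM2l // mulr_ge0 ?exprn_ge0.
Qed.
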